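(* Let $p$ and $x_0\in\mathbb{R}^p$ be fixed, let $J:\mathbb{R}^p\to[0,+\infty)$ be a finite-valued convex function, and let $\mathcal{M}\subset\mathbb{R}^p$ be a set containing $x_0$ such that $J$ is locally partly smooth at $x_0$ relative to $\mathcal{M}$. Let $(\xi_i,w_i)_{i\ge1}$ be independent and identically distributed random vectors in $\mathbb{R}^p\times\mathbb{R}$ with $\mathbb{E}(w_i\mid\xi_i)=0$, $\mathbb{E}(w_i^4)<+\infty$ and $\mathbb{E}(\|\xi_i\|^4)<+\infty$. For each $n$ let $\Phi\in\mathbb{R}^{n\times p}$ be the matrix whose $i$-th row is $\xi_i$, $w=(w_1,\dots,w_n)$, $y=\Phi x_0+w$, and let $\theta_n=(\mu_n,u_n,\Gamma_n)$ with $\mu_n>0$, $u_n=\Phi^*y/n$, $\Gamma_n=\Phi^*\Phi/n$. Let $\tilde\Gamma=\mathbb{E}(\xi^*\xi)\in\mathbb{R}^{p\times p}$, where $\xi$ is any row of $\Phi$ (as a row vector). Assume that, with $T=T_{x_0}$, $$\ker(\tilde\Gamma)\cap T=\{0\}\quad\text{and}\quad \eta_{\tilde\Gamma}\in\mathrm{ri}(\partial J(x_0)),$$ and that $$\mu_n=o(1)\quad\text{and}\quad \mu_n^{-1}=o(n^{1/2})\qquad (n\to\infty).$$ Then the estimator $x_{\theta_n}$ of $x_0$ obtained by solving $(\mathcal{P}_{\theta_n})$ is model consistent, i.e. $$\lim_{n\to+\infty}\Pr\left(x_{\theta_n}\in\mathcal{M}\right)=1.$$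
   Context: Problem $(\mathcal{P}_\theta)$ for $\theta=(\mu,u,\Gamma)$ with $\mu>0$: $$\min_{x\in\mathbb{R}^p}\ J(x)+\frac{1}{2\mu}\langle\Gamma x,x\rangle-\frac1\mu\langle x,u\rangle+\frac{1}{2\mu}\langle\Gamma^+u,u\rangle ,$$ where $A^+$ is the Moore–Penrose pseudo-inverse of $A$. For $\theta=\theta_n$ it is equivalent to minimizing $J(x)+\frac{1}{2n\mu_n}\|\Phi x-y\|^2$. The variables $w_i$ and $\xi_i$ need not be independent of each other, and $\tilde\Gamma$ is not assumed invertible. Notation: $\partial J$ is the convex subdifferential; $\mathrm{ri}$ is the relative interior. For a convex set $\mathcal{C}$, $\mathrm{VecHull}(\mathcal{C})=\{\rho(x-x'):(x,x')\in\mathcal{C}^2,\rho\in\mathbb{R}\}$ and its linear span is the subspace parallel to the affine hull of $\mathcal{C}$. The tangent model subspace at $x$ is $T_x=\mathrm{VecHull}(\partial J(x))^\perp$. $P_T$ is the orthogonal projection onto a subspace $T$, and $\Gamma_T=P_T\Gamma P_T$. With $T=T_{x_0}$, the vector $e=P_T(\partial J(x_0))$ is well defined (the projection onto $T$ of any element of $\partial J(x_0)$). For a matrix $\tilde\Gamma$ with $\ker(\tilde\Gamma)\cap T=\{0\}$, the linearized pre-certificate is $\eta_{\tilde\Gamma}=\tilde\Gamma\,\tilde\Gamma_T^+e$. Partial smoothness: a finite-valued convex function $J$ is partly smooth at $x$ relative to a set $\mathcal{M}$ containing $x$ if (i) $\mathcal{M}$ is a $C^2$-manifold (embedded in $\mathbb{R}^p$)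 around $x$ and $J$ restricted to $\mathcal{M}$ is $C^2$ around $x$; (ii) the tangent space of $\mathcal{M}$ at $x$ is $T_x$; (iii) the set-valued mapping $\partial J$ is continuous at $x$ relative to $\mathcal{M}$ (equivalently, since $J$ is finite convex: for any sequence $x_n\in\mathcal{M}$ with $x_n\to x$ and any $\eta\in\partial J(x)$, there exist $\eta_n\in\partial J(x_n)$ with $\eta_n\to\eta$). $J$ is locally partly smooth at $x$ relative to $\mathcal{M}$ if $\mathcal{M}$ is a manifold and there is a neighbourhood $U$ of $x$ such that $J$ is partly smooth at every $x'\in\mathcal{M}\cap U$ relative to $\mathcal{M}$. *)

(* Defs.v *)
From HB Require Import structures.
From mathcomp Require Import all_boot all_order all_algebra finmap.
From mathcomp Require Import all_classical all_reals all_analysis.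
Set Implicit Arguments.
Unset Strict Implicit.
Unset Printing Implicit Defensive.
Import Order.TTheory GRing.Theory Num.Theory.
Import numFieldNormedType.Exports.
Local Open Scope classical_set_scope.
Local Open Scope ring_scope.

(* R^p is ['cV[R]_p].  Its library norm is the sup norm: it is only used for
   the topology, the Euclidean structure being [dotp] and [enorm]. *)

Section Euclidean.
Context {R : realType}.

Definition dotp (p : nat) (x y : 'cV[R]_p) : R := \sum_i x i 0 * y i 0.

Definition enorm (p : nat) (x : 'cV[R]_p) : R := Num.sqrt (dotp x x).

Definition orthogonal (p : nat) (A : set 'cV[R]_p) : set 'cV[R]_p :=
  [set x | forall a, A a -> dotp x a = 0].

Definition is_orth_proj (p : nat) (T : set 'cV[R]_p) (Q : 'M[R]_p) :=
  forall x, T (Q *m x) /\ forall t, T t -> dotp (x - Q *m x) t = 0.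

(* Unique when T is a subspace; junk otherwise. *)
Definition orth_proj (p : nat) (T : set 'cV[R]_p) : 'M[R]_p :=
  xget 0 (is_orth_proj T).

Definition is_mppinv (m n : nat) (A : 'M[R]_(m, n)) (B : 'M[R]_(n, m)) :=
  [/\ A *m B *m A = A, B *m A *m B = B,
      (A *m B)^T = A *m B & (B *m A)^T = B *m A].

(* The Moore-Penrose pseudo-inverse (unlike [pinvmx] of mxalgebra). *)
Definition mppinv (m n : nat) (A : 'M[R]_(m, n)) : 'M[R]_(n, m) :=
  xget 0 (is_mppinv A).

End Euclidean.

Section Convexity.
Context {R : realType} {p : nat}.
Implicit Types (C : set 'cV[R]_p) (J : 'cV[R]_p -> R) (x : 'cV[R]_p).

Definition VecHull C : set 'cV[R]_p :=
  [set v | exists rho x x', [/\ C x, C x' & v = rho *: (x - x')]].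

Definition affine_hull C : set 'cV[R]_p :=
  [set y | exists (k : nat) (c : 'I_k -> 'cV[R]_p) (a : 'I_k -> R),
     [/\ forall i, C (c i), \sum_i a i = 1 & y = \sum_i a i *: c i]].

Definition relint C : set 'cV[R]_p :=
  [set x | C x /\ \forall y \near x, affine_hull C y -> C y].

Definition subdifferential J x : set 'cV[R]_p :=
  [set g | forall y, J x + dotp g (y - x) <= J y].

Definition model_space J x : set 'cV[R]_p :=
  orthogonal (VecHull (subdifferential J x)).

(* P_T maps the subdifferential (nonempty for J finite convex) to a single
   point, which is the value chosen by [xget]. *)
Definition model_vector J x : 'cV[R]_p :=
  xget 0 [set orth_proj (model_space J x) *m g | g in subdifferential J x].

Definition restrict_mx (T : set 'cV[R]_p) (G : 'M[R]_p) : 'M[R]_p :=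
  orth_proj T *m G *m orth_proj T.

Definition precertificate J x (G : 'M[R]_p) : 'cV[R]_p :=
  G *m mppinv (restrict_mx (model_space J x) G) *m model_vector J x.

End Convexity.

Section PartialSmoothness.
Context {R : realType}.

Definition C1_on (V W : normedModType R) (U : set V) (f : V -> W) :=
  forall x, U x -> differentiable f x /\
    forall v, {for x, continuous (fun y => 'd f y v)}.

Definition C2_on (V W : normedModType R) (U : set V) (f : V -> W) :=
  C1_on U f /\ forall v, C1_on U (fun y => 'd f y v).

Context {p : nat}.
Implicit Types (M : set 'cV[R]_p) (J : 'cV[R]_p -> R) (x : 'cV[R]_p).

(* Embedded manifolds are given by local equations with linearly independent
   differentials. *)
Definition C2_manifold_around M x :=
  M x /\ exists (U : set 'cV[R]_p) (k : nat) (F : 'I_k -> 'cV[R]_p -> R),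
    [/\ open_nbhs x U, forall i, C2_on U (F i),
        M `&` U = [set y | U y /\ forall i, F i y = 0]
      & forall c : 'I_k -> R,
          (forall v, \sum_i c i * ('d (F i) x v : R) = 0) ->
          forall i, c i = 0].

Definition C2_manifold M := forall x, M x -> C2_manifold_around M x.

(* Velocities at x of the C^2 curves drawn on M. *)
Definition tangent_space M x : set 'cV[R]_p :=
  [set v | exists (c : R -> 'cV[R]_p) (U : set R),
     [/\ open_nbhs (0 : R) U, C2_on U c, forall t, U t -> M (c t),
         c 0 = x & 'D_1 c 0 = v]].

(* J|_M is C^2 around x when it has a C^2 local extension. *)
Definition C2_restriction_around M J x :=
  exists (U : set 'cV[R]_p) (g : 'cV[R]_p -> R),
    [/\ open_nbhs x U, C2_on U g & forall y, M y -> U y -> g y = J y].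

Definition inner_semicontinuous_at M (S : 'cV[R]_p -> set 'cV[R]_p) x :=
  forall (xs : nat -> 'cV[R]_p) (g : 'cV[R]_p),
    (forall n, M (xs n)) -> xs @ \oo --> x -> S x g ->
    exists gs : nat -> 'cV[R]_p,
      (forall n, S (xs n) (gs n)) /\ gs @ \oo --> g.

Definition outer_semicontinuous_at M (S : 'cV[R]_p -> set 'cV[R]_p) x :=
  forall (xs gs : nat -> 'cV[R]_p) (g : 'cV[R]_p),
    (forall n, M (xs n)) -> xs @ \oo --> x ->
    (forall n, S (xs n) (gs n)) -> gs @ \oo --> g -> S x g.

(* For S the subdifferential of a finite convex function, outer semicontinuity
   always holds. *)
Definition setvalued_continuous_at M (S : 'cV[R]_p -> set 'cV[R]_p) x :=
  inner_semicontinuous_at M S x /\ outer_semicontinuous_at M S x.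

Definition partly_smooth J M x :=
  [/\ C2_manifold_around M x, C2_restriction_around M J x,
      tangent_space M x = model_space J x
    & setvalued_continuous_at M (subdifferential J) x].

Definition locally_partly_smooth J M x :=
  [/\ M x, C2_manifold M & \forall x' \near x, M x' -> partly_smooth J M x'].

End PartialSmoothness.

Section Probability.
Context {R : realType} {d : measure_display} {Omega : measurableType d}.
Variable P : probability Omega R.

(* A topological space with its Borel sigma-algebra. *)
Definition borel (T : ptopologicalType) := g_sigma_algebraType (@open T).

Definition independent d' (T : measurableType d') (Z : nat -> Omega -> T) :=
  forall (I : {fset nat}) (B : nat -> set T),
    (forall i, measurable (B i)) ->
    P (\bigcap_(i in [set` I]) (Z i @^-1` B i)) =
    (\prod_(i <- I) P (Z i @^-1` B i))%E.

Definition identically_distributed d' (T : measurableType d')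
    (Z : nat -> Omega -> T) :=
  forall i j (B : set T), measurable B -> P (Z i @^-1` B) = P (Z j @^-1` B).

Definition iid d' (T : measurableType d') (Z : nat -> Omega -> T) :=
  [/\ forall i, measurable_fun setT (Z i), independent Z
    & identically_distributed Z].

(* Y is a version of E(X | Z). *)
Definition is_cond_expectation d' (T : measurableType d') (X : Omega -> R)
    (Z : Omega -> T) (Y : Omega -> R) :=
  let sigmaZ := preimage_set_system setT Z measurable in
  [/\ P.-integrable setT (EFin \o X), P.-integrable setT (EFin \o Y),
      forall B : set R, measurable B -> sigmaZ (Y @^-1` B)
    & forall A, sigmaZ A ->
        (\int[P]_(omega in A) (X omega)%:E = \int[P]_(omega in A) (Y omega)%:E)%E].

End Probability.

Section Estimation.
Context {R : realType} {p : nat}.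

Definition objective (J : 'cV[R]_p -> R) (mu : R) (u : 'cV[R]_p)
    (G : 'M[R]_p) (x : 'cV[R]_p) : R :=
  J x + (2 * mu)^-1 * dotp (G *m x) x - mu^-1 * dotp x u
  + (2 * mu)^-1 * dotp (mppinv G *m u) u.

Definition solutions (J : 'cV[R]_p -> R) (mu : R) (u : 'cV[R]_p)
    (G : 'M[R]_p) : set 'cV[R]_p :=
  [set x | forall z, objective J mu u G x <= objective J mu u G z].

(* Samples are numbered from 0: the first n ones have indices i < n. *)
Context {Omega : Type} (xi : nat -> Omega -> 'rV[R]_p) (w : nat -> Omega -> R).

Definition design n (omega : Omega) : 'M[R]_(n, p) :=
  \matrix_(i < n, j < p) xi i omega 0 j.

Definition noise n (omega : Omega) : 'cV[R]_n := \col_(i < n) w i omega.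

Definition observation (x0 : 'cV[R]_p) n (omega : Omega) : 'cV[R]_n :=
  design n omega *m x0 + noise n omega.

Definition emp_corr (x0 : 'cV[R]_p) n (omega : Omega) : 'cV[R]_p :=
  n%:R^-1 *: ((design n omega)^T *m observation x0 n omega).

Definition emp_cov n (omega : Omega) : 'M[R]_p :=
  n%:R^-1 *: ((design n omega)^T *m design n omega).

End Estimation.

Definition second_moment {R : realType} {d : measure_display}
    {Omega : measurableType d} (P : probability Omega R) {p : nat}
    (xi : Omega -> 'rV[R]_p) : 'M[R]_p :=
  \matrix_(j, k) fine 'E_P[fun omega => ((xi omega)^T *m xi omega) j k].

Section WellDefinedness.
Context {R : realType}.

Lemma dotp_mulmx p (x y : 'cV[R]_p) : dotp x y = (x^T *m y) 0 0.
Proof. by rewrite mxE; apply: eq_bigr => i _; rewrite mxE. Qed.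

Lemma dotp_eq0 p (x : 'cV[R]_p) : dotp x x = 0 -> x = 0.
Proof.
move/eqP; rewrite psumr_eq0; last by move=> i _; rewrite -expr2 sqr_ge0.
move/allP => h; apply/matrixP => i j; rewrite ord1 mxE; apply/eqP.
by have := h i (mem_index_enum i); rewrite /= mulf_eq0 orbb.
Qed.

Lemma row_free_gram m n (A : 'M[R]_(m, n)) : row_free A -> A *m A^T \in unitmx.
Proof.
move=> fA; rewrite -row_free_unit -kermx_eq0; apply/eqP/row_matrixP => i.
rewrite row0; set v := row i _.
have : v *m (A *m A^T) = 0 by apply/sub_kermxP; exact: row_sub.
rewrite mulmxA => vA.
have : (v *m A)^T = 0.
  apply: dotp_eq0; rewrite dotp_mulmx trmxK trmx_mul mulmxA vA.
  by rewrite mul0mx mxE.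
move/(congr1 trmx); rewrite trmxK trmx0 => vA0.
by apply/eqP; rewrite -(mulmx_free_eq0 _ fA) vA0.
Qed.

Lemma is_mppinv_mul m n r (C : 'M[R]_(m, r)) (D : 'M[R]_(r, n)) :
  row_full C -> row_free D ->
  is_mppinv (C *m D) (D^T *m invmx (D *m D^T) *m invmx (C^T *m C) *m C^T).
Proof.
move=> fC /row_free_gram uD.
have uC : C^T *m C \in unitmx.
  rewrite -[X in _ *m X]trmxK; apply: row_free_gram.
  by rewrite /row_free mxrank_tr.
set K := invmx (C^T *m C); set L := invmx (D *m D^T).
have KT : K^T = K by rewrite /K trmx_inv trmx_mul trmxK.
have LT : L^T = L by rewrite /L trmx_inv trmx_mul trmxK.
have AB : C *m D *m (D^T *m L *m K *m C^T) = C *m K *m C^T.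
  by rewrite !mulmxA -(mulmxA C) -(mulmxA C _ L) mulmxV// mulmx1.
have BA : D^T *m L *m K *m C^T *m (C *m D) = D^T *m L *m D.
  by rewrite !mulmxA -(mulmxA _ C^T) -(mulmxA _ K) mulVmx// mulmx1.
split.
- by rewrite AB !mulmxA -(mulmxA _ C^T) -(mulmxA _ K) mulVmx// mulmx1.
- rewrite BA !mulmxA -(mulmxA _ D) -(mulmxA _ (D *m _) L) mulmxV//.
  by rewrite mulmx1.
- by rewrite AB !trmx_mul trmxK KT mulmxA.
- by rewrite BA !trmx_mul trmxK LT mulmxA.
Qed.

Lemma mppinvP m n (A : 'M[R]_(m, n)) : is_mppinv A (mppinv A).
Proof.
have := is_mppinv_mul (col_base_full A) (row_base_free A).
by rewrite mulmx_base => hB; exact: (xgetI _ hB).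
Qed.

Lemma is_mppinv_uniq m n (A : 'M[R]_(m, n)) B : is_mppinv A B -> B = mppinv A.
Proof.
have := mppinvP A; set C := mppinv A.
move=> [c1 c2 c3 c4] [b1 b2 b3 b4].
have AB : A *m B = A *m C.
  by rewrite -b3 -{1}c1 -(mulmxA _ A) trmx_mul b3 c3 mulmxA b1.
have BA : B *m A = C *m A.
  rewrite -b4 -{1}c1 !mulmxA -(mulmxA _ C) trmx_mul b4 c4 -!mulmxA.
  by rewrite (mulmxA A B) b1.
by rewrite -b2 BA -mulmxA AB mulmxA c2.
Qed.

Lemma orth_projP p (A : set 'cV[R]_p) :
  is_orth_proj (orthogonal A) (orth_proj (orthogonal A)).
Proof.
suff [Q hQ] : exists Q, is_orth_proj (orthogonal A) Q by exact: (xgetI _ hQ).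
set T := orthogonal A.
have subT (B : 'M[R]_p) : (forall i, T (row i B)^T) -> forall s, T (B^T *m s).
  move=> hB s a Aa; rewrite dotp_mulmx trmx_mul trmxK -mulmxA mxE.
  apply: big1 => i _; suff -> : (B *m a) i 0 = 0 by rewrite mulr0.
  by rewrite -(hB i a Aa) dotp_mulmx trmxK -row_mul [RHS]mxE.
pose good k := `[< exists2 B : 'M[R]_p, (forall i, T (row i B)^T) & \rank B = k >].
have good0 : exists k, good k.
  exists 0%N; apply/asboolP; exists 0; last exact: mxrank0.
  by move=> i a _; rewrite row0 dotp_mulmx trmxK mul0mx mxE.
have goodp k : good k -> (k <= p)%N.
  by move=> /asboolP[B _ <-]; exact: rank_leq_row.
case: (ex_maxnP good0 goodp) => r /asboolP[B TB rB] rmax.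
have spanT t : T t -> (t^T <= B)%MS.
  move=> Tt; pose D := (B + t^T)%MS.
  have DT : forall i, T (row i D)^T.
    move=> i a Aa; have : (row i D <= B + t^T)%MS by exact: row_sub.
    case/sub_addsmxP => -[u v] /= ->; rewrite dotp_mulmx trmxK mulmxDl mxE.
    have /(_ a Aa) := subT B TB u^T.
    rewrite dotp_mulmx trmx_mul !trmxK => ->; rewrite add0r -mulmxA mxE.
    by rewrite big_ord1 -dotp_mulmx Tt// mulr0.
  have : (\rank D <= r)%N by apply: rmax; apply/asboolP; exists D.
  rewrite -rB => rD; apply: submx_trans (addsmxSr B _) _.
  by rewrite -(geq_leqif (mxrank_leqif_sup (addsmxSl B t^T))).
have [b1 b2 b3 b4] := mppinvP B.
exists (mppinv B *m B) => x; split.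
  by rewrite -b4 trmx_mul -mulmxA; exact: subT.
move=> t /spanT /submxP[s /(congr1 trmx)]; rewrite trmxK trmx_mul => ->.
rewrite dotp_mulmx mulmxA -trmx_mul mulmxBr !mulmxA b1 subrr.
by rewrite trmx0 mul0mx mxE.
Qed.

End WellDefinedness.

(* Main.v *)
(* Write u_n = Gamma_n x0 + e_n.  By the weak law of large numbers Gamma_n tends
   to Gamma~ in probability, and E(w | xi) = 0 gives e_n = O_P(n^{-1/2}), hence
   e_n = o_P(mu_n).  It therefore suffices to solve a deterministic problem: when
   mu, Gamma - Gamma~ and e / mu are small, the objective has a unique minimizer
   and it lies in M.

   Let x_n minimize the objective over M intersected with a small ball.  Every
   limit d of x_n - x0 satisfies Gamma~ d = 0 and, the pre-certificate being
   relatively interior, d is in T, so x_n -> x0.  The same argument applied to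
   directions gives x_n - x0 = O(mu_n).  The first order condition on M then
   forces eta_n = (u_n - Gamma_n x_n) / mu_n to tend to the pre-certificate.
   If eta_n were not a subgradient at x_n, a violating direction, projected on the
   normal space of M and normalized, would have a nonzero limit which is normal to
   M and, by relative interiority, in T: a contradiction.  So x_n is a global
   minimizer, and a second minimizer would produce a nonzero element of
   ker Gamma~ and T in the same way.

   Limits are taken along ultrafilters instead of subsequences.  M enters through
   its equations F = 0; metric regularity replaces the implicit function theorem
   in the proof of the Lagrange multiplier rule. *)
Require Import Defs.
From HB Require Import structures.
From mathcomp Require Import all_boot all_order all_algebra finmap.
From mathcomp Require Import all_classical all_reals all_analysis.
From mathcomp Require Import measurable_realfun ring lra.
Set Implicit Arguments.
Unset Strict Implicit.
Unset Printing Implicit Defensive.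
Import Order.TTheory GRing.Theory Num.Theory.
Import numFieldNormedType.Exports.
Local Open Scope classical_set_scope.
Local Open Scope ring_scope.

(* MathComp has another [orthogonal], which shadows the one of Defs. *)
Local Notation orthogonal := Defs.orthogonal.

(** * Euclidean space and limits *)

Section Dotp.
Context {R : realType} {p : nat}.
Implicit Types (x y z : 'cV[R]_p) (a : R).

Lemma dotpC x y : dotp x y = dotp y x.
Proof. by apply: eq_bigr => i _; rewrite mulrC. Qed.

Lemma dotpDl x y z : dotp (x + y) z = dotp x z + dotp y z.
Proof. by rewrite -big_split; apply: eq_bigr => i _; rewrite mxE mulrDl. Qed.

Lemma dotpZl a x y : dotp (a *: x) y = a * dotp x y.
Proof. by rewrite /dotp mulr_sumr; apply: eq_bigr => i _; rewrite mxE mulrA. Qed.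

Lemma dotpDr x y z : dotp z (x + y) = dotp z x + dotp z y.
Proof. by rewrite dotpC dotpDl !(dotpC z). Qed.

Lemma dotpZr a x y : dotp x (a *: y) = a * dotp x y.
Proof. by rewrite dotpC dotpZl dotpC. Qed.

Lemma dotpNl x y : dotp (- x) y = - dotp x y.
Proof. by rewrite -scaleN1r dotpZl mulN1r. Qed.

Lemma dotpNr x y : dotp x (- y) = - dotp x y.
Proof. by rewrite dotpC dotpNl dotpC. Qed.

Lemma dotpBl x y z : dotp (x - y) z = dotp x z - dotp y z.
Proof. by rewrite dotpDl dotpNl. Qed.

Lemma dotpBr x y z : dotp z (x - y) = dotp z x - dotp z y.
Proof. by rewrite dotpDr dotpNr. Qed.

Lemma dotp0l x : dotp 0 x = 0.
Proof. by rewrite -(scale0r 0) dotpZl mul0r. Qed.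

Lemma dotp0r x : dotp x 0 = 0.
Proof. by rewrite dotpC dotp0l. Qed.

Lemma dotp_ge0 x : 0 <= dotp x x.
Proof. by apply: sumr_ge0 => i _; rewrite -expr2 sqr_ge0. Qed.

Lemma dotp_sumr I (r : seq I) (P : pred I) (F : I -> 'cV[R]_p) x :
  dotp x (\sum_(i <- r | P i) F i) = \sum_(i <- r | P i) dotp x (F i).
Proof.
elim/big_rec2: _ => [|i a b _ <-]; first exact: dotp0r.
by rewrite dotpDr.
Qed.

Lemma dotp_sym_mulmx (G : 'M[R]_p) x y :
  G^T = G -> dotp (G *m x) y = dotp x (G *m y).
Proof. by move=> GT; rewrite !dotp_mulmx trmx_mul GT mulmxA. Qed.

Lemma psd_form_eq0 (G : 'M[R]_p) x : G^T = G ->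
  (forall y, 0 <= dotp (G *m y) y) -> dotp (G *m x) x = 0 -> G *m x = 0.
Proof.
move=> GT G_ge0 Gxx; apply: dotp_eq0; set g := G *m x.
have Hs (s : R) : 0 <= dotp (G *m g) g * s ^+ 2 - 2 * s * dotp g g.
  have := G_ge0 (x - s *: g).
  rewrite mulmxBr -scalemxAr !(dotpBl, dotpBr, dotpZl, dotpZr) -/g Gxx.
  by rewrite (dotp_sym_mulmx g x GT) -/g => H; rewrite (le_trans H)//; lra.
have := dotp_ge0 g; rewrite le_eqVlt => /predU1P[//|g_gt0].
set c := dotp (G *m g) g in Hs; set q := dotp g g in Hs g_gt0 *.
have c_ge0 : 0 <= c by exact: G_ge0.
(* The polynomial is minimal at [q / c]; dividing by [c + 1] instead also covers [c = 0]. *)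
have := Hs (q / (c + 1)).
have c1 : 0 < c + 1 by lra.
have -> : c * (q / (c + 1)) ^+ 2 - 2 * (q / (c + 1)) * q =
  - (q ^+ 2 * (c + 2)) / (c + 1) ^+ 2 by field; rewrite gt_eqF.
rewrite mulNr oppr_ge0 pmulr_lle0 ?invr_gt0 ?exprn_gt0//.
by rewrite leNgt mulr_gt0 ?exprn_gt0//; lra.
Qed.

End Dotp.

(** * Sup norm of matrices, entrywise limits and compactness *)

Section MatrixNorm.
Context {R : realType}.

Lemma le_coord_mx_norm m n (A : 'M[R]_(m, n)) i j : `|A i j| <= `|A|.
Proof.
rewrite [leRHS]/Num.Def.normr/= mx_normrE.
exact: (le_bigmax _ (fun x => `|A x.1 x.2|) (i, j)).
Qed.

Lemma mx_norm_le m n (A : 'M[R]_(m, n)) e : 0 <= e ->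
  (forall i j, `|A i j| <= e) -> `|A| <= e.
Proof. by move=> e0 Ae; rewrite /Num.Def.normr/= mx_normrE; apply/bigmax_leP. Qed.

Lemma sqr_norm_le_dotp p (x : 'cV[R]_p) : `|x| ^+ 2 <= dotp x x.
Proof.
rewrite -[leRHS](@sqr_sqrtr _ _ (dotp_ge0 x)) lerXn2r ?nnegrE ?sqrtr_ge0//.
apply: mx_norm_le => [|i j]; first exact: sqrtr_ge0.
rewrite -sqrtr_sqr ler_sqrt ?dotp_ge0// ord1 expr2.
by rewrite /dotp (bigD1 i)//= lerDl sumr_ge0// => k _; rewrite -expr2 sqr_ge0.
Qed.

Lemma norm_dotp_le p (x y : 'cV[R]_p) : `|dotp x y| <= p%:R * (`|x| * `|y|).
Proof.
apply: le_trans (ler_norm_sum _ _ _) _.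
apply: (@le_trans _ _ (\sum_(i < p) (`|x| * `|y|))); last first.
  by rewrite sumr_const card_ord mulr_natl.
by apply: ler_sum => i _; rewrite normrM ler_pM// le_coord_mx_norm.
Qed.

Lemma norm_mulmx_le m n q (A : 'M[R]_(m, n)) (B : 'M[R]_(n, q)) :
  `|A *m B| <= n%:R * (`|A| * `|B|).
Proof.
apply: mx_norm_le => [|i j]; first by rewrite !mulr_ge0.
rewrite mxE; apply: le_trans (ler_norm_sum _ _ _) _.
apply: (@le_trans _ _ (\sum_(k < n) (`|A| * `|B|))); last first.
  by rewrite sumr_const card_ord mulr_natl.
by apply: ler_sum => k _; rewrite normrM ler_pM// le_coord_mx_norm.
Qed.

Section Cvg.
Context {T : Type} {F : set_system T} {FF : Filter F}.

Lemma cvg_coord m n (f : T -> 'M[R]_(m, n)) (A : 'M[R]_(m, n)) i j :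
  f @ F --> A -> (fun t => f t i j) @ F --> A i j.
Proof.
move=> fA; apply: (@cvg_comp _ _ _ f (fun B : 'M[R]_(m, n) => B i j)).
  exact: fA.
exact: coord_continuous.
Qed.

Lemma cvg_mx m n (f : T -> 'M[R]_(m, n)) (A : 'M[R]_(m, n)) :
  (forall i j, (fun t => f t i j) @ F --> A i j) -> f @ F --> A.
Proof.
move=> fA; apply/cvgrPdist_le => e e0.
have : \forall t \near F, forall i j, `|A i j - f t i j| <= e.
  apply: filter_forall => i; apply: filter_forall => j.
  by move/cvgrPdist_le : (fA i j); exact.
apply: filterS => t H; apply: mx_norm_le => [|i j]; first exact: ltW.
by rewrite !mxE.
Qed.

Lemma cvg_bigsum I (r : seq I) (f : I -> T -> R) (a : I -> R) :
  (forall i, f i @ F --> a i) ->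
  (fun t => \sum_(i <- r) f i t) @ F --> \sum_(i <- r) a i.
Proof.
move=> fa; elim: r => [|i r IH].
  rewrite big_nil; under eq_fun do rewrite big_nil; exact: cvg_cst.
rewrite big_cons; under eq_fun do rewrite big_cons.
by apply: cvgD.
Qed.

Lemma cvg_mulmx m n q (f : T -> 'M[R]_(m, n)) (g : T -> 'M[R]_(n, q))
    (A : 'M[R]_(m, n)) (B : 'M[R]_(n, q)) :
  f @ F --> A -> g @ F --> B -> (fun t => f t *m g t) @ F --> A *m B.
Proof.
move=> fA gB; apply: cvg_mx => i j; rewrite mxE.
under eq_fun do rewrite mxE.
by apply: cvg_bigsum => k; apply: cvgM; exact: cvg_coord.
Qed.

Lemma cvg_dotp p (f g : T -> 'cV[R]_p) (x y : 'cV[R]_p) :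
  f @ F --> x -> g @ F --> y -> (fun t => dotp (f t) (g t)) @ F --> dotp x y.
Proof.
by move=> fx gy; apply: cvg_bigsum => i; apply: cvgM; exact: cvg_coord.
Qed.

Lemma cvg_trmx m n (f : T -> 'M[R]_(m, n)) (A : 'M[R]_(m, n)) :
  f @ F --> A -> (fun t => (f t)^T) @ F --> A^T.
Proof.
move=> fA; apply: cvg_mx => i j; rewrite mxE.
by under eq_fun do rewrite mxE; exact: cvg_coord.
Qed.

End Cvg.

Lemma cvg_to_le T (F : set_system T) {PF : ProperFilter F} (f : T -> R)
  (a b : R) : f @ F --> a -> (\forall t \near F, f t <= b) -> a <= b.
Proof.
move=> fa fb; rewrite -(cvg_lim (@norm_hausdorff _ _) fa).
by apply: limr_le => //; apply/cvg_ex; exists a.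
Qed.

Lemma cvg_to_ge T (F : set_system T) {PF : ProperFilter F} (f : T -> R)
  (a b : R) : f @ F --> a -> (\forall t \near F, b <= f t) -> b <= a.
Proof.
move=> fa fb; rewrite -lerN2; apply: cvg_to_le (cvgN fa) _.
by apply: filterS fb => t; rewrite fctE lerN2.
Qed.

(** Transposition is continuous and carries the claim to row vectors. *)
Lemma bounded_closed_compact_cV p (A : set 'cV[R]_p) (C : R) :
  (forall x, A x -> `|x| <= C) -> closed A -> compact A.
Proof.
move=> AC Acl.
have -> : A = trmx @` (trmx @^-1` A : set 'rV[R]_p).
  apply/seteqP; split => [x Ax|_ [y Ay <-]//].
  by exists x^T; rewrite /= ?trmxK.
have trC m n : continuous (@trmx R m n).
  by move=> x; apply: (@cvg_trmx _ (nbhs x) _ m n id x); exact: cvg_id.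
apply: continuous_compact; first exact: (continuous_subspaceT (trC 1%N p)).
apply: bounded_closed_compact; last first.
  by apply: closed_comp => // x _; exact: trC.
exists `|C|; split; first exact: num_real.
move=> x Cx y Ay; apply: mx_norm_le.
  by rewrite ltW// (le_lt_trans _ Cx).
move=> i j; have -> : y i j = y^T j i by rewrite mxE.
apply: (le_trans (le_coord_mx_norm _ _ _)).
by rewrite (le_trans (AC _ Ay))// (le_trans (ler_norm _))// ltW.
Qed.

Lemma compact_cball p (c : 'cV[R]_p) (r : R) :
  compact [set x | `|x - c| <= r].
Proof.
apply: (@bounded_closed_compact_cV _ _ (`|c| + r)).
  move=> x /= xr; rewrite -(subrK c x) addrC.
  by rewrite (le_trans (ler_normD _ _))// lerD2l.
apply: (@closed_comp _ _ (fun x : 'cV[R]_p => `|x - c|) [set y | y <= r]).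
  by move=> x _; apply: (@cvg_norm _ _ _ (nbhs x)); apply: cvgB;
    [exact: cvg_id|exact: cvg_cst].
exact: closed_le.
Qed.

Lemma ultra_fmap T V (U : set_system T) (f : T -> V) :
  UltraFilter U -> UltraFilter (f @ U).
Proof.
move=> UU; split=> [|G GF fUG]; first exact: fmap_proper_filter.
apply/seteqP; split => // A GA.
have [//|UnA] := in_ultra_setVsetC (f @^-1` A) UU.
have GnA : G (~` A) by exact: fUG.
by have /filter_ex [? []] : G (A `&` ~` A) by exact: filterI.
Qed.

(** The image ultrafilter contains a compact ball, hence converges. This plays the role of
    extracting a convergent subsequence. *)
Lemma ultra_bounded_cvg T (U : set_system T) p (f : T -> 'cV[R]_p) (C : R) :
  UltraFilter U -> (\forall t \near U, `|f t| <= C) ->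
  exists l : 'cV[R]_p, f @ U --> l.
Proof.
move=> UU fC.
have := @compact_cball p 0 C; rewrite compact_ultra.
move=> /(_ _ (ultra_fmap f UU))[|l [_ fl]]; last by exists l.
by apply: filterS fC => t; rewrite /= subr0.
Qed.

End MatrixNorm.

(** * Metric regularity and Lagrange multipliers *)

Section Lagrange.
Context {R : realType} {p : nat}.
Implicit Types (x y z v : 'cV[R]_p) (f : 'cV[R]_p -> R).

Definition grad f x : 'cV[R]_p := \col_i ('d f x (delta_mx i 0) : R).

Lemma diff_gradE f x v : ('d f x v : R) = dotp (grad f x) v.
Proof.
have {1}-> : v = \sum_i v i 0 *: delta_mx i 0.
  rewrite {1}[v]matrix_sum_delta; apply: eq_bigr => i _.
  by rewrite big_ord1.
rewrite linear_sum; apply: eq_bigr => i _.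
by rewrite linearZ mxE mulrC.
Qed.

Lemma gradE f x i j : grad f x i j = ('d f x (delta_mx i 0) : R).
Proof. by rewrite mxE. Qed.

Lemma cvg_grad f (U : set 'cV[R]_p) x : C1_on U f -> U x ->
  grad f @ x --> grad f x.
Proof.
move=> fC1 Ux; have := gradE f; move: (grad f) => G GE.
apply: (@cvg_mx _ _ (nbhs x) _ _ _ G (G x)) => i j.
have [_ /(_ (delta_mx i 0)) dfC] := fC1 x Ux.
rewrite GE; under eq_fun do rewrite GE; exact: dfC.
Qed.

(** Fréchet differentiability with an explicit gradient, in an epsilon form that is easily carried
    through the addition of linear and quadratic terms. *)
Definition has_gradient f x g := forall e : R, 0 < e ->
  \forall h \near (0 : 'cV[R]_p),
    `|f (x + h) - f x - dotp g h| <= e * `|h|.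

Lemma differentiable_gradient f x :
  differentiable f x -> has_gradient f x (grad f x).
Proof.
move=> df e e0; have /eqaddoP/(_ _ e0) := diff_locally df.
apply: filterS => h /=; rewrite -diff_gradE.
by rewrite !fctE opprD addrA [h + x]addrC.
Qed.

(** Quantitative independence of the gradients: on [A], the transposed Jacobian expands squared
    Euclidean lengths by a factor at least [c]. *)
Definition regular_on k (F : 'I_k -> 'cV[R]_p -> R) (c : R)
    (A : set 'cV[R]_p) := forall y, A y ->
  (forall i, differentiable (F i) y) /\ forall l : 'I_k -> R,
    let g := \sum_i l i *: grad (F i) y in c * \sum_i l i ^+ 2 <= dotp g g.

(* Minimize |F| + lam |. - z| over the ball: at a minimizer where F <> 0, moving
   along - \sum_i F_i grad F_i decreases |F| faster than lam times the distance
   travelled. *)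
Lemma metric_regularity k (F : 'I_k -> 'cV[R]_p -> R) x0 (r c lam : R) z :
  regular_on F c [set y | `|y - x0| <= r] -> 0 < lam -> lam ^+ 2 < c ->
  let res := Num.sqrt (\sum_i F i z ^+ 2) / lam in
  `|z - x0| + res < r ->
  exists y, [/\ `|y - x0| < r, `|y - z| <= res & forall i, F i y = 0].
Proof.
move=> Freg lam0 lamc res zr.
pose psi y := \sum_i F i y ^+ 2; have psi0 y : 0 <= psi y.
  by apply: sumr_ge0 => i _; exact: sqr_ge0.
pose phi y := Num.sqrt (psi y) + lam * `|y - z|.
have Bz : `|z - x0| <= r.
  by rewrite (le_trans _ (ltW zr))// lerDl divr_ge0 ?sqrtr_ge0// ltW.
have psiC y : `|y - x0| <= r -> {for y, continuous psi}.
  move=> /Freg[dF _]; rewrite /prop_for/continuous_at/psi.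
  apply: (@cvg_bigsum _ _ (nbhs y)) => i.
  apply: (@cvg_comp _ _ _ (F i) (fun u : R => u ^+ 2));
    last exact: exprn_continuous.
  exact: (differentiable_continuous (dF i)).
have [||y] := @compact_EVT_min _ _ phi _ _ (@compact_cball _ _ x0 r).
- by exists z.
- apply: continuous_in_subspaceT => y /[!inE] /= yr.
  apply: (@cvgD _ _ _ (nbhs y)).
    exact: (continuous_cvg _ (@sqrt_continuous _ _) (psiC _ yr)).
  apply: (@cvgM _ _ (nbhs y)); first exact: cvg_cst.
  by apply: (@cvg_norm _ _ _ (nbhs y)); apply: cvgB; [exact: cvg_id|exact: cvg_cst].
rewrite inE/= => yr ymin.
have yz : `|y - z| <= res.
  rewrite /res ler_pdivlMr// mulrC.
  have := ymin z; rewrite inE/= => /(_ Bz); rewrite /phi subrr normr0 mulr0 addr0.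
  by apply: le_trans; rewrite lerDr sqrtr_ge0.
have {yr}yr : `|y - x0| < r.
  rewrite (le_lt_trans _ zr)// [leRHS]addrC -(subrK z y) -addrA.
  by rewrite (le_trans (ler_normD _ _))// lerD2r.
exists y; split => //; apply: contrapT => Fy.
have psiy : 0 < psi y.
  rewrite lt_neqAle psi0 andbT eq_sym; apply/negP => /eqP psiy; apply: Fy => i.
  have := psiy; rewrite /psi => /eqP; rewrite psumr_eq0 => [|j _]; last exact: sqr_ge0.
  by move=> /allP/(_ i (mem_index_enum i)); rewrite /= sqrf_eq0 => /eqP.
have [dF /(_ (fun i => F i y))] := Freg y (ltW yr).
set g := \sum_i _; rewrite -/(psi y) /= => Hg.
set q := dotp g g in Hg.
set s := Num.sqrt (psi y).
have s0 : 0 < s by rewrite sqrtr_gt0.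
have s2 : s ^+ 2 = psi y by rewrite sqr_sqrtr.
have q0 : 0 < q.
  rewrite (lt_le_trans _ Hg)// mulr_gt0// (le_lt_trans _ lamc)//.
  by rewrite sqr_ge0.
(* Regularity gives c s^2 <= q and the norm comparison |g|^2 <= q, so the square of the left side is
   at most lam^2 s^2 q < c s^2 q <= q^2. *)
have lsq : lam * s * `|g| < q.
  rewrite -(@ltr_pXn2r _ 2)// ?nnegrE ?mulr_ge0//; [|exact: ltW..].
  rewrite exprMn exprMn s2 [ltRHS]expr2.
  apply: (@le_lt_trans _ _ (lam ^+ 2 * psi y * q)).
    by rewrite ler_wpM2l ?sqr_norm_le_dotp// mulr_ge0 ?sqr_ge0.
  by rewrite ltr_pM2r// (lt_le_trans _ Hg)// ltr_pM2r.
(* The vector [g] is half the gradient of [psi] at [y]. *)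
have dpsi : is_derive y (- g) psi (- (2 * q)).
  have -> : psi = \sum_i (F i ^+ 2).
    by apply/funext => u; rewrite fct_sumE.
  have dFi i : is_derive y (- g) (F i) (- dotp (grad (F i) y) g).
    by rewrite -dotpNr -diff_gradE -deriveE//; apply/derivableP/diff_derivable.
  apply: is_derive_eq.
  have -> : q = \sum_i F i y * dotp (grad (F i) y) g.
    rewrite /q {2}/g dotp_sumr; apply: eq_bigr => i _.
    by rewrite dotpZr dotpC.
  rewrite mulr_sumr -sumrN; apply: eq_bigr => i _.
  by rewrite expr1 scalerN mulrA.
have [t t0 Ht] : exists2 t : R, 0 < t &
    `|y + t *: (- g) - x0| <= r /\
    psi (y + t *: (- g)) - psi y < - (2 * lam * s * `|g|) * t.
  have /cvg_dnbhs_at_right qt : h^-1 *: ((psi \o shift y) (h *: - g) - psi y)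
      @[h --> 0^'] --> - (2 * q).
    by have [+ <-] := dpsi.
  have lsq2 : - (2 * q) < - (2 * lam * s * `|g|) by lra.
  have rg : 0 < (r - `|y - x0|) / (`|g| + 1).
    by rewrite divr_gt0 ?subr_gt0// ltr_wpDl.
  near (0 : R)^'+ => t; have t0 : 0 < t by [].
  exists t => //; split.
    rewrite addrAC (le_trans (ler_normD _ _))// -lerBrDl normrZ normrN gtr0_norm//.
    apply: (@le_trans _ _ (t * (`|g| + 1))).
      by rewrite ler_wpM2l ?lerDl// ltW.
    rewrite -ler_pdivlMr ?ltr_wpDl//.
    by near: t; exact: nbhs_right_le.
  rewrite -ltr_pdivrMr// mulrC [y + _]addrC.
  by near: t; exact: (cvgr_lt _ qt).
have [Bt Dt] := Ht.
have := ymin (y + t *: (- g)); rewrite inE => /(_ Bt); apply/negP.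
rewrite -ltNge /phi.
set b := psi _ in Dt *.
(* Concavity of the square root: 2 s (sqrt b - s) <= b - s^2, which is the decrease of [psi]. *)
have sb : Num.sqrt b - s < - (lam * `|g|) * t.
  have : 0 <= (Num.sqrt b - s) ^+ 2 by exact: sqr_ge0.
  rewrite sqrrB sqr_sqrtr ?psi0// s2 => H.
  rewrite -(@ltr_pM2l _ (2 * s)) ?mulr_gt0//.
  by lra.
have : `|y + t *: - g - z| <= `|y - z| + t * `|g|.
  rewrite addrAC (le_trans (ler_normD _ _))// lerD2l normrZ normrN.
  by rewrite gtr0_norm.
rewrite -(ler_pM2l lam0) -/s mulrDr.
by lra.
Unshelve. all: by end_near.
Qed.

(** The Jacobian [A x] has a right inverse [B]. For [y] near [x], [L *m A y *m B] differs from [L]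
    by at most half of |L|, which bounds |L| by a multiple of |L A(y)|. *)
Lemma regular_near k (F : 'I_k -> 'cV[R]_p -> R) (U : set 'cV[R]_p) x :
  open_nbhs x U -> (forall i, C1_on U (F i)) ->
  (forall c : 'I_k -> R, (forall v, \sum_i c i * ('d (F i) x v : R) = 0) ->
    forall i, c i = 0) ->
  exists r c : R, [/\ 0 < r, 0 < c, [set y | `|y - x| <= r] `<=` U &
    regular_on F c [set y | `|y - x| <= r]].
Proof.
move=> Ux FC1 Find; have xU : U x by case: Ux.
have [A [AE Aij]] : exists A : 'cV[R]_p -> 'M[R]_(k, p),
    (forall (l : 'I_k -> R) y,
      ((\row_i l i) *m A y)^T = \sum_i l i *: grad (F i) y) /\
    forall y i j, A y i j = ('d (F i) y (delta_mx j 0) : R).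
  exists (fun y => \matrix_(i, j) grad (F i) y j 0); split => [l y|y i j].
    apply/matrixP => j u; rewrite !mxE summxE ord1; apply: eq_bigr => i _.
    by rewrite !mxE.
  by rewrite !mxE.
have /row_freeP[B AB] : row_free (A x).
  rewrite -kermx_eq0; apply/eqP/row_matrixP => i.
  rewrite row0; set l := row i _.
  have lA : l *m A x = 0 by apply/sub_kermxP; exact: row_sub.
  have lE : l = \row_i l 0 i by apply/rowP => j; rewrite mxE.
  apply/rowP => j; rewrite [RHS]mxE; apply: (Find (fun i => l 0 i)) => v.
  transitivity (dotp (\sum_i l 0 i *: grad (F i) x) v); last first.
    by rewrite -AE -lE lA trmx0 dotp0l.
  rewrite dotpC dotp_sumr; apply: eq_bigr => u _.
  by rewrite dotpZr dotpC -diff_gradE.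
have Acvg : A @ x --> A x.
  apply: (@cvg_mx _ _ (nbhs x) _ k p A (A x)) => i j.
  have [_ /(_ (delta_mx j 0)) dFC] := FC1 i x xU.
  rewrite Aij; under eq_fun do rewrite Aij.
  exact: dFC.
pose K := p%:R * `|B| + 1.
have pB : 0 <= p%:R * `|B| by rewrite mulr_ge0.
have K0 : 0 < K by rewrite /K; lra.
have k1 : 0 < k%:R + 1 :> R by rewrite ltr_wpDl.
have : \forall y \near x, U y /\ `|A x - A y| <= (2 * K * (k%:R+1))^-1.
  apply: filterI; first by apply: open_nbhs_nbhs.
  by move/cvgrPdist_le: Acvg; apply; rewrite invr_gt0 !mulr_gt0.
case/nbhs_ballP => /= e e0 He.
(* The factor (2K)^2 comes from |L| <= 2K |L A(y)|; [k + 1] compares the sum of squares with the sup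
   norm and stays positive when [k] is 0. *)
exists (e / 2), (((2 * K) ^+ 2 * (k%:R + 1))^-1).
have near_ball y : `|y - x| <= e / 2 -> ball x e y.
  move=> yx; rewrite mx_norm_ball /ball_/= distrC (le_lt_trans yx)//.
  by rewrite ltr_pdivrMr// ltr_pMr// ltr1n.
split => //.
- by rewrite divr_gt0.
- by rewrite invr_gt0 mulr_gt0// exprn_gt0// mulr_gt0.
- by move=> y /= /near_ball/He[].
- move=> y /= /near_ball/He[Uy Ay]; split=> [i|l].
    by have [] := FC1 i y Uy.
  set g := \sum_i l i *: grad (F i) y.
  set L : 'rV[R]_k := \row_i l i.
  have gE : `|L *m A y| ^+ 2 <= dotp g g.
    rewrite /g -AE; apply: le_trans (sqr_norm_le_dotp _).
    rewrite lerXn2r ?nnegrE// -/L; apply: mx_norm_le => // i j.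
    have -> : (L *m A y) i j = (L *m A y)^T j i by rewrite [RHS]mxE.
    exact: le_coord_mx_norm.
  have LE : `|L| <= 2 * K * `|L *m A y|.
    have : L = L *m A y *m B + L *m (A x - A y) *m B.
      by rewrite -mulmxDl -mulmxDr addrC subrK -mulmxA AB mulmx1.
    set m := `|L *m A y| => LE.
    have LE' : `|L| <= `|L *m A y *m B| + `|L *m (A x - A y) *m B|.
      by rewrite {1}LE ler_normD.
    have H1 : `|L *m A y *m B| <= (K - 1) * m.
      by rewrite (le_trans (norm_mulmx_le _ _))// /K addrK -/m mulrAC mulrA.
    have H2 : `|L *m (A x - A y) *m B| <= 2^-1 * `|L|.
      apply: (le_trans (norm_mulmx_le _ _)).
      apply: (@le_trans _ _
        (p%:R * (k%:R * (`|L| * (2 * K * (k%:R + 1))^-1) * `|B|))).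
        rewrite ler_wpM2l// ler_wpM2r// (le_trans (norm_mulmx_le _ _))//.
        by rewrite ler_wpM2l// ler_wpM2l.
      have -> : p%:R * (k%:R * (`|L| * (2 * K * (k%:R + 1))^-1) * `|B|) =
          (p%:R * `|B|) * k%:R / (2 * K * (k%:R + 1)) * `|L| by ring.
      rewrite ler_wpM2r// ler_pdivrMr ?mulr_gt0//.
      rewrite mulrA mulrA mulVf// mul1r ler_pM//; first by rewrite /K lerDl.
      by rewrite lerDl.
    have m0 : 0 <= m by exact: normr_ge0.
    by lra.
  have sL : \sum_i l i ^+ 2 <= (k%:R + 1) * `|L| ^+ 2.
    apply: (@le_trans _ _ (\sum_(i < k) `|L| ^+ 2)).
      apply: ler_sum => i _; rewrite -(real_normK (num_real (l i))).
      rewrite lerXn2r ?nnegrE// (le_trans _ (le_coord_mx_norm L 0 i))//.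
      by rewrite mxE.
    by rewrite sumr_const card_ord mulrDl mulr_natl mul1r lerDl sqr_ge0.
  rewrite mulrC ler_pdivrMr ?mulr_gt0 ?exprn_gt0 ?mulr_gt0//.
  apply: (le_trans sL).
  have -> : dotp g g * ((2 * K) ^+ 2 * (k%:R + 1)) =
    (k%:R + 1) * ((2 * K) ^+ 2 * dotp g g) by ring.
  rewrite ler_wpM2l ?(ltW k1)//.
  apply: (@le_trans _ _ ((2 * K * `|L *m A y|) ^+ 2)).
    by rewrite lerXn2r ?nnegrE ?mulr_ge0// ltW.
  by rewrite exprMn ler_wpM2l// sqr_ge0.
Qed.

(** At x + t v the equations fail by o(t) only, so metric regularity finds a zero of [F] at distance
    o(t). If [dotp g v] were negative, the first order decrease of [f] would survive this correction
    and contradict minimality. *)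
Lemma lagrange_ge0 k (F : 'I_k -> 'cV[R]_p -> R) f g x0 (r c : R) x v :
  0 < c -> regular_on F c [set y | `|y - x0| <= r] ->
  `|x - x0| < r -> (forall i, F i x = 0) -> has_gradient f x g ->
  (\forall y \near x, (forall i, F i y = 0) -> f x <= f y) ->
  (forall i, dotp (grad (F i) x) v = 0) -> 0 <= dotp g v.
Proof.
move=> c0 Freg xr Fx df fmin Fv; rewrite leNgt; apply/negP => a0.
set a := dotp g v in a0.
pose lam := Num.sqrt c / 2.
have lam0 : 0 < lam by rewrite divr_gt0// sqrtr_gt0.
have lamc : lam ^+ 2 < c by rewrite exprMn sqr_sqrtr ?ltW//; lra.
pose C := (k%:R + 1) * `|v| / lam.
have k1 : 0 < k%:R + 1 :> R by rewrite ltr_wpDl.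
have C0 : 0 <= C by rewrite divr_ge0 ?(ltW lam0)// mulr_ge0// ltW.
pose D := p%:R * (`|g| * C) + `|v| + C + 1.
have D0 : 0 < D.
  apply: ltr_wpDl => //; apply: addr_ge0 => //; apply: addr_ge0 => //.
  by apply: mulr_ge0 => //; exact: mulr_ge0.
(* [D] gathers the coefficients of all errors of order e t; this choice keeps their sum below half
   of the decrease - a t, and [e <= 1] absorbs the terms in e^2. *)
pose e := Num.min 1 (- a / (2 * D)).
have e0 : 0 < e by rewrite lt_min ltr01/= divr_gt0 ?oppr_gt0// mulr_gt0.
have e1 : e <= 1 by rewrite ge_min lexx.
have eD : e * D <= - a / 2.
  have : e <= - a / (2 * D) by rewrite ge_min lexx orbT.
  by rewrite -(ler_pM2r D0) invfM !mulrA mulfVK// gt_eqF.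
have tv0 : (fun t : R => t *: v) @ 0^'+ --> (0 : 'cV[R]_p).
  rewrite -[X in _ --> X](scale0r v); apply: cvgZr_tmp.
  by apply: cvg_at_right_filter; exact: cvg_id.
have small (A d : R) : 0 < d -> \forall t \near (0 : R)^'+, t * A < d.
  move=> d0; near=> t; have t0 : 0 < t by [].
  apply: (@le_lt_trans _ _ (t * (`|A| + 1))).
    by rewrite ler_wpM2l ?(ltW t0)// (le_trans (ler_norm _))// lerDl.
  have A1 : 0 < `|A| + 1 by rewrite ltr_wpDl.
  rewrite -ltr_pdivlMr//; near: t; apply: nbhs_right_lt.
  by rewrite divr_gt0.
have [d d0 Hd] : exists2 d : R, 0 < d & forall h, `|h| < d ->
    ((forall i, F i (x + h) = 0) -> f x <= f (x + h)) /\
    `|f (x + h) - f x - dotp g h| <= e * `|h|.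
  have /nbhs_ballP[d1 /= d10 H1] := fmin.
  have /nbhs_ballP[d2 /= d20 H2] := df e e0.
  exists (Num.min d1 d2); first by rewrite lt_min d10.
  move=> h; rewrite lt_min => /andP[h1 h2]; split.
    apply: H1; rewrite mx_norm_ball /ball_/=.
    by rewrite opprD addrA subrr add0r normrN.
  by apply: H2; rewrite mx_norm_ball /ball_/= add0r normrN.
near (0 : R)^'+ => t; have t0 : 0 < t by [].
pose z := x + t *: v.
have Fz i : `|F i z| <= e * t * `|v|.
  have : forall i, `|F i (x + t *: v) - F i x - dotp (grad (F i) x) (t *: v)|
      <= e * `|t *: v|.
    near: t; apply: filter_forall => j.
    have [/(_ j) dFj _] := Freg x (ltW xr).
    exact: (tv0 _ (differentiable_gradient dFj e0)).
  move=> /(_ i); rewrite Fx dotpZr Fv mulr0 !subr0 normrZ gtr0_norm//.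
  by rewrite mulrA.
set res := Num.sqrt (\sum_i F i z ^+ 2) / lam.
have resC : res <= t * (e * C).
  rewrite /res ler_pdivrMr//.
  have -> : t * (e * C) * lam = t * e * (k%:R + 1) * `|v|.
    by rewrite /C; field; rewrite gt_eqF.
  have X0 : 0 <= t * e * (k%:R + 1) * `|v|.
    by apply: mulr_ge0 => //; rewrite !mulr_ge0// ltW.
  rewrite -(ger0_norm X0) -sqrtr_sqr ler_wsqrtr//.
  apply: (@le_trans _ _ (\sum_(i < k) (e * t * `|v|) ^+ 2)).
    apply: ler_sum => i _; rewrite -(real_normK (num_real (F i z))).
    by rewrite lerXn2r ?nnegrE// mulr_ge0// mulr_ge0 ?ltW.
  rewrite sumr_const card_ord -[leLHS]mulr_natl.
  have -> : (t * e * (k%:R + 1) * `|v|) ^+ 2 =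
    (k%:R + 1) ^+ 2 * (e * t * `|v|) ^+ 2 by ring.
  rewrite ler_wpM2r ?sqr_ge0// expr2.
  have : (0 : R) <= k%:R by [].
  have : 0 <= k%:R * k%:R :> R by rewrite mulr_ge0.
  by lra.
have [//|//|//||y [yr yz Fy]] := @metric_regularity k F x0 r c lam z.
  rewrite -/res; apply: (@le_lt_trans _ _ (`|x - x0| + t * (`|v| + e * C))).
    rewrite mulrDr addrA lerD// /z addrAC (le_trans (ler_normD _ _))//.
    by rewrite lerD2l normrZ gtr0_norm.
  rewrite -ltrBrDl; near: t; apply: small; by rewrite subr_gt0.
have {}yz : `|y - z| <= t * (e * C) by exact: le_trans yz resC.
have hle : `|y - x| <= t * (`|v| + e * C).
  have -> : y - x = t *: v + (y - z) by rewrite /z opprD [RHS]addrC addrA subrK.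
  rewrite (le_trans (ler_normD _ _))// mulrDr lerD//.
  by rewrite normrZ gtr0_norm.
have hd : `|y - x| < d.
  by rewrite (le_lt_trans hle)//; near: t; exact: small.
have [+ Hexp] := Hd _ hd; rewrite addrC subrK => /(_ Fy) fxy.
have gE : dotp g (y - x) <= t * a + p%:R * (`|g| * (t * (e * C))).
  have -> : y - x = t *: v + (y - z) by rewrite /z opprD [RHS]addrC addrA subrK.
  rewrite dotpDr dotpZr lerD2l (le_trans (ler_norm _))//.
  by rewrite (le_trans (norm_dotp_le _ _))// ler_wpM2l// ler_wpM2l.
have eh : e * `|y - x| <= e * (t * (`|v| + C)).
  rewrite ler_wpM2l ?(ltW e0)// (le_trans hle)// ler_wpM2l ?(ltW t0)//.
  by rewrite lerD2l ler_piMl.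
move: Hexp; rewrite [x + _]addrC subrK ler_norml => /andP[_ Hexp].
have : 0 <= t * (a + e * D).
  rewrite /D.
  have et : 0 <= e * t by rewrite mulr_ge0// ltW.
  by lra.
rewrite pmulr_rge0// leNgt => /negP; apply.
by rewrite (le_lt_trans (lerD (lexx _) eD))//; lra.
Unshelve. all: by end_near.
Qed.

End Lagrange.

(** * Normal spaces, relative interiors and ultrafilters *)

Section Subspaces.
Context {R : realType} {p : nat}.
Implicit Types (x v : 'cV[R]_p) (A C : set 'cV[R]_p) (J : 'cV[R]_p -> R).

Lemma orthogonalZ A (a : R) v : orthogonal A v -> orthogonal A (a *: v).
Proof. by move=> Av y /Av yv; rewrite dotpZl yv mulr0. Qed.

Lemma orthogonalD A x v :
  orthogonal A x -> orthogonal A v -> orthogonal A (x + v).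
Proof. by move=> Ax Av y Ay; rewrite dotpDl Ax// Av// addr0. Qed.

Lemma orthogonal_VecHullP C v : orthogonal (VecHull C) v <->
  forall a b, C a -> C b -> dotp a v = dotp b v.
Proof.
split=> [Cv a b Ca Cb|Cv _ [rho [a [b [Ca Cb ->]]]]].
  apply/eqP; rewrite -subr_eq0 -dotpBl dotpC -[a - b]scale1r; apply/eqP/Cv.
  by exists 1, a, b.
by rewrite dotpZr dotpBr !(dotpC v) (Cv _ _ Ca Cb) subrr mulr0.
Qed.

Lemma orth_proj_id A v : orthogonal A v -> orth_proj (orthogonal A) *m v = v.
Proof.
move=> Av; have [Pv /(_ (v - orth_proj (orthogonal A) *m v))] := orth_projP A v.
set u := _ *m v in Pv *; have TvPv : orthogonal A (v - u).
  by apply: orthogonalD => //; rewrite -scaleN1r; exact: orthogonalZ.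
by move=> /(_ TvPv)/dotp_eq0/eqP; rewrite subr_eq0 => /eqP.
Qed.

Lemma orth_proj_sym A : (orth_proj (orthogonal A))^T = orth_proj (orthogonal A).
Proof.
set P := orth_proj _; have PA := orth_projP A; rewrite -/P in PA.
have Psym x y : dotp (P *m x) y = dotp x (P *m y).
  have [Px Hx] := PA x; have [Py Hy] := PA y.
  have := Hy _ Px; have := Hx _ Py.
  rewrite !dotpBl => /eqP; rewrite subr_eq0 => /eqP -> /eqP.
  by rewrite subr_eq0 dotpC => /eqP ->; rewrite dotpC.
have deltaE i (x : 'cV[R]_p) : dotp x (delta_mx i 0) = x i 0.
  rewrite /dotp (bigD1 i)//= big1 => [|j /negPf ji]; rewrite mxE ?eqxx ?ji.
    by rewrite mulr1 addr0.
  by rewrite mulr0.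
have PE i j : P i j = dotp (P *m delta_mx j 0) (delta_mx i 0).
  by rewrite deltaE -colE mxE.
by apply/matrixP => i j; rewrite mxE !PE Psym dotpC.
Qed.

Lemma orth_proj_eq0 A v :
  (forall t, orthogonal A t -> dotp v t = 0) -> orth_proj (orthogonal A) *m v = 0.
Proof.
move=> Av; have [Pv] := orth_projP A v; set u := _ *m v in Pv *.
move=> /(_ _ Pv); rewrite dotpBl Av// sub0r => /eqP; rewrite oppr_eq0 => /eqP.
exact: dotp_eq0.
Qed.

(** A segment from [e] to [eta] can be prolonged inside [C] beyond [eta]. A strict inequality at [e]
    would make the prolongation exceed the maximum, so [v] is constant on [C]. *)
Lemma relint_maximal C eta v : relint C eta ->
  (forall e, C e -> dotp e v <= dotp eta v) -> orthogonal (VecHull C) v.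
Proof.
move=> [Ceta aff_near] etamax.
suff E e : C e -> dotp e v = dotp eta v.
  by apply/orthogonal_VecHullP => a b /E -> /E ->.
move=> Ce; apply/eqP; rewrite eq_le etamax//=.
have cvg_line : (fun t : R => eta + t *: (eta - e)) @ 0^'+ --> eta.
  rewrite -[X in _ --> X]addr0 -(scale0r (eta - e)).
  apply: cvgD; first exact: cvg_cst.
  by apply: cvgZr_tmp; apply: cvg_at_right_filter; exact: cvg_id.
have line_near := cvg_line _ aff_near.
near (0 : R)^'+ => t; have t0 : 0 < t by [].
have /etamax : C (eta + t *: (eta - e)).
  suff aff_t : affine_hull C (eta + t *: (eta - e)).
    by move: aff_t; near: t; exact: line_near.
  (* The prolonged point is the affine combination of [eta] and [e] with weights 1 + t and - t. *)
  exists 2, (fun i : 'I_2 => if i == ord0 then eta else e),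
    (fun i : 'I_2 => if i == ord0 then 1 + t else - t).
  rewrite !big_ord_recl !big_ord0/= !addr0 addrK; split => //.
    by move=> i; case: ifP.
  by rewrite scalerDl scale1r scalerBr scaleNr addrA.
rewrite dotpDl dotpZl dotpBl gerDl pmulr_rle0//.
by rewrite subr_le0.
Unshelve. all: by end_near.
Qed.

(** A row space is the annihilator of the kernel: the columns of [cokermx N] serve as test vectors
    [w]. *)
Lemma orthogonal_kernel_span k (u : 'I_k -> 'cV[R]_p) v :
  (forall w, (forall i, dotp (u i) w = 0) -> dotp v w = 0) ->
  exists l : 'I_k -> R, v = \sum_i l i *: u i.
Proof.
move=> uv; pose N : 'M[R]_(k, p) := \matrix_(i, j) u i j 0.
have rowN i : row i N = (u i)^T by apply/rowP => j; rewrite !mxE.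
have : (v^T <= N)%MS.
  rewrite submxE; apply/eqP/matrixP => i j; rewrite [RHS]mxE ord1.
  have -> : (v^T *m cokermx N) 0 j = dotp v (col j (cokermx N)).
    by rewrite mxE; apply: eq_bigr => l _; rewrite !mxE.
  apply: uv => l; transitivity ((N *m cokermx N) l j).
    by rewrite mxE; apply: eq_bigr => m _; rewrite !mxE.
  by rewrite mulmx_coker mxE.
case/submxP => L vL; exists (fun i => L 0 i).
apply/trmx_inj; rewrite vL mulmx_sum_row linear_sum; apply: eq_bigr => i _.
by rewrite rowN linearZ.
Qed.

End Subspaces.

(** * Reduction of limits along a filter to limits along finer ultrafilters *)

Section UltraCvg.

(** If [A] were not in [F], the trace of [F] on the complement of [A] would be proper and extend to
    an ultrafilter that avoids [A]. *)
Lemma ultra_near (T : Type) (F : set_system T) (A : set T) :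
  ProperFilter F -> (forall U, UltraFilter U -> F `<=` U -> U A) -> F A.
Proof.
move=> PF UA; apply: contrapT => FA.
have wP : ProperFilter (within (~` A) F).
  split; last exact: within_filter.
  move=> w; apply: FA.
  by apply: (@filterS _ F _ _ _ _ w) => t; exact: contrapT.
have [U [UU wU]] := ultraFilterLemma wP.
have FU : F `<=` U by apply: subset_trans wU; exact: cvg_within.
have UnA : U (~` A) by apply: wU; exact: withinT.
by have [? []] := filter_ex (filterI (UA U UU FU) UnA).
Qed.

Lemma ultra_cvg (T : Type) (V : topologicalType) (F : set_system T)
  (f : T -> V) (l : V) : ProperFilter F ->
  (forall U, UltraFilter U -> F `<=` U -> f @ U --> l) -> f @ F --> l.
Proof.
move=> PF Fl N Nl; apply: (ultra_near (A := f @^-1` N) PF) => U UU FU.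
exact: (Fl U UU FU N Nl).
Qed.

Lemma finer_cvg (T : Type) (V : topologicalType) (F U : set_system T)
  (f : T -> V) (l : V) : F `<=` U -> f @ F --> l -> f @ U --> l.
Proof. by move=> FU fl A /fl; exact: FU. Qed.

Lemma ultra_near_or (T : Type) (U : set_system T) (A : set T) :
  UltraFilter U -> (\forall t \near U, A t) \/ (\forall t \near U, ~ A t).
Proof. by move=> UU; exact: in_ultra_setVsetC. Qed.

End UltraCvg.

(** * The local equations of a partly smooth function *)

Section LocalModel.
Context {R : realType} {p : nat}.
Variables (J : 'cV[R]_p -> R) (M : set 'cV[R]_p) (x0 : 'cV[R]_p).
Implicit Types x v z : 'cV[R]_p.

(* Near x0, M is the regular zero set of F and g is a smooth extension of J|_M. *)
Definition local_model k (F : 'I_k -> 'cV[R]_p -> R) (g : 'cV[R]_p -> R)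
    (r c : R) := [/\ 0 < r, 0 < c, regular_on F c [set y | `|y - x0| <= r],
  forall y, `|y - x0| <= r -> M y <-> forall i, F i y = 0 &
  forall y, `|y - x0| <= r -> differentiable g y /\ (M y -> g y = J y)] .

Lemma local_model_ex : C2_manifold_around M x0 -> C2_restriction_around M J x0 ->
  exists k (F : 'I_k -> 'cV[R]_p -> R) g r c, local_model F g r c /\
    forall i, grad (F i) @ x0 --> grad (F i) x0.
Proof.
move=> [Mx0 [U [k [F [[oU Ux0] FC2 MU Find]]]]] [W [g [[oW Wx0] [gC1 _] gJ]]].
have FC1 i : C1_on U (F i) by have [] := FC2 i.
have oUW : open_nbhs x0 (U `&` W) by split; [exact: openI|].
have FC1' i : C1_on (U `&` W) (F i) by move=> x [Ux _]; exact: FC1.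
have [r [c [r0 c0 rUW Freg]]] := regular_near oUW FC1' Find.
exists k, F, g, r, c; split.
  split => // y /rUW[Uy Wy].
    have MUy : (M `&` U) y = (U y /\ forall i, F i y = 0) by rewrite MU.
    split=> [My|Fy]; first by have : (M `&` U) y by []; rewrite MUy => -[].
    by have : U y /\ forall i, F i y = 0 by []; rewrite -MUy => -[].
  by split; [have [] := gC1 y Wy|move=> My; exact: gJ].
by move=> i; apply: cvg_grad (FC1 i) Ux0.
Qed.

(** [F] vanishes along every curve drawn on [M] near [x0]; the chain rule differentiates this
    identity. *)
Lemma tangent_space_grad (F : 'cV[R]_p -> R) (r : R) v : 0 < r ->
  differentiable F x0 -> (forall y, `|y - x0| <= r -> M y -> F y = 0) ->
  tangent_space M x0 v -> dotp (grad F x0) v = 0.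
Proof.
move=> r0 dF MF [c [U [[oU U0] [cC1 _] cM c0 Dc]]].
have [dc _] := cC1 0 U0.
have dFc : differentiable F (c 0) by rewrite c0.
rewrite -diff_gradE -Dc deriveE// -c0.
have <- : 'd (F \o c) 0 (1 : R) = 'd F (c 0) ('d c 0 (1 : R)).
  by rewrite diff_comp.
rewrite -deriveE; last exact: differentiable_comp.
rewrite (near_eq_derive (g := cst 0)) ?derive_cst ?oner_eq0//.
have cc : c @ 0 --> x0 by rewrite -c0; exact: differentiable_continuous.
move/cvgrPdist_le : cc => /(_ _ r0) cr.
near=> t; apply: MF => /=; last by apply: cM; near: t; exact: open_nbhs_nbhs.
by rewrite distrC; near: t.
Unshelve. all: by end_near. Qed.

(** Tangency read off the equations of [M] rather than off curves; this form also makes sense at the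
    moving points near [x0]. *)
Definition in_kernel k (F : 'I_k -> 'cV[R]_p -> R) x v :=
  forall i, dotp (grad (F i) x) v = 0.

Context {k : nat} {F : 'I_k -> 'cV[R]_p -> R} {g : 'cV[R]_p -> R} {r c : R}.
Hypothesis model : local_model F g r c.

(** The kernel contains [- v] along with [v], so the one-sided condition of [lagrange_ge0] becomes
    an equality. *)
Lemma lagrange_eq0 f (h : 'cV[R]_p) x v : `|x - x0| < r -> M x ->
  has_gradient f x h -> (forall y, `|y - x0| <= r -> M y -> f x <= f y) ->
  in_kernel F x v -> dotp h v = 0.
Proof.
have [r0 c0 Freg MF _] := model.
move=> xr Mx fh fmin xv; apply/eqP; rewrite eq_le -oppr_ge0 -dotpNr.
have Fx : forall i, F i x = 0 by apply/MF => //; exact: ltW.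
have fmin' : \forall y \near x, (forall i, F i y = 0) -> f x <= f y.
  have dr : 0 < r - `|x - x0| by rewrite subr_gt0.
  apply/nbhs_ballP; exists (r - `|x - x0|) => // y.
  rewrite mx_norm_ball /ball_/= => xy Fy.
  have yr : `|y - x0| <= r.
    have -> : y - x0 = (x - x0) - (x - y) by rewrite opprB [RHS]addrC addrA subrK.
    by rewrite (le_trans (ler_normB _ _))// -lerBrDl ltW.
  by apply: fmin => //; apply/MF.
have step := lagrange_ge0 c0 Freg xr Fx fh fmin'.
rewrite !step// => i; rewrite dotpNr xv oppr0//.
Qed.

Lemma has_gradientB f h x zeta : has_gradient f x h ->
  has_gradient (fun y => f y - dotp zeta y) x (h - zeta).
Proof.
move=> fh e /fh; apply: filterS => u; congr (`|_| <= _).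
by rewrite dotpDr dotpBl; ring.
Qed.

(** A subgradient [zeta] makes [x] a minimizer of J - <zeta, .>, hence of g - <zeta, .> on [M] in
    the ball, and the multiplier rule applies to the latter. *)
Lemma subdifferential_kernel x zeta v : `|x - x0| < r -> M x ->
  subdifferential J x zeta -> in_kernel F x v ->
  dotp zeta v = dotp (grad g x) v.
Proof.
have [r0 c0 Freg MF gJ] := model; move=> xr Mx Jzeta xv.
have [dg gx] := gJ x (ltW xr).
apply/eqP; rewrite eq_sym -subr_eq0 -dotpBl; apply/eqP.
apply: (lagrange_eq0 xr Mx (has_gradientB zeta (differentiable_gradient dg))) => //.
move=> y yr My; have [_ ->//] := gJ y yr; rewrite gx//.
by have := Jzeta y; rewrite dotpBr; lra.
Qed.

(** All subgradients at [x0] act on the kernel as [grad g x0], so they agree there. The converse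
    inclusion will come from the tangent space condition of partial smoothness. *)
Lemma kernel_model_space v : M x0 -> in_kernel F x0 v -> model_space J x0 v.
Proof.
move=> Mx0 v0; apply/orthogonal_VecHullP => a b Ja Jb.
have [r0 _ _ _ _] := model.
by rewrite !(@subdifferential_kernel x0 _ v)// subrr normr0.
Qed.

End LocalModel.

(** * Identification along a sequence of problems *)

Section Core.
Context {R : realType} {p : nat}.
Implicit Types (x v z : 'cV[R]_p) (U : set_system nat).
Variables (J : 'cV[R]_p -> R) (M : set 'cV[R]_p) (x0 : 'cV[R]_p).
Variables (k : nat) (F : 'I_k -> 'cV[R]_p -> R) (g : 'cV[R]_p -> R) (r c : R).
Hypothesis Mx0 : M x0.
Hypothesis model : local_model J M x0 F g r c.
Hypothesis gradF : forall i, grad (F i) @ x0 --> grad (F i) x0.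
Hypothesis T_kernel : forall v, model_space J x0 v -> in_kernel F x0 v.
Hypothesis J_isc : inner_semicontinuous_at M (subdifferential J) x0.
Variable Gt : 'M[R]_p.
Hypothesis Gt_inj : forall v, Gt *m v = 0 -> model_space J x0 v -> v = 0.
Let eta0 := precertificate J x0 Gt.
Hypothesis eta0_relint : relint (subdifferential J x0) eta0.
Variables (mu : nat -> R) (G : nat -> 'M[R]_p) (eps : nat -> 'cV[R]_p).
Hypothesis mu_gt0 : forall n, 0 < mu n.
Hypothesis mu0 : mu @ \oo --> (0 : R).
Hypothesis GT : forall n, (G n)^T = G n.
Hypothesis G_ge0 : forall n v, 0 <= dotp (G n *m v) v.
Hypothesis GGt : G @ \oo --> Gt.
Hypothesis eps0 : (fun n => (mu n)^-1 *: eps n) @ \oo --> (0 : 'cV[R]_p).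

(** The objective for u = A x0 + e, up to a constant (see [objective_centered]). The function [h] is
    either [J] or its smooth extension [g]. *)
Definition centered_objective (h : 'cV[R]_p -> R) (m : R) (A : 'M[R]_p)
    (e : 'cV[R]_p) z : R :=
  h z + (2 * m)^-1 * dotp (A *m (z - x0)) (z - x0) - m^-1 * dotp e (z - x0).

(** The vector paired with [u] is minus the gradient of the data term at [z]; that term being
    quadratic, the expansion is exact. *)
Lemma centered_objective_expand h m (A : 'M[R]_p) e z u : A^T = A ->
  centered_objective h m A e (z + u) - centered_objective h m A e z =
  h (z + u) - h z - dotp (m^-1 *: e - m^-1 *: (A *m (z - x0))) u
  + (2 * m)^-1 * dotp (A *m u) u.
Proof.
move=> AT; rewrite /centered_objective [z + u - x0]addrAC.
move: (z - x0) => w; rewrite mulmxDr !(dotpDl, dotpDr, dotpNl, dotpZl).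
rewrite [dotp (A *m u) w]dotp_sym_mulmx// (dotpC u).
by rewrite invfM; move: (m^-1) => i; field.
Qed.

Lemma has_gradient_centered h m (A : 'M[R]_p) e z dh : A^T = A -> 0 < m ->
  has_gradient h z dh -> has_gradient (centered_objective h m A e) z
    (dh - (m^-1 *: e - m^-1 *: (A *m (z - x0)))).
Proof.
move=> AT m0 hz del del0; have del2 : 0 < del / 2 by rewrite divr_gt0.
(* A bound on the coefficient of |u|^2 in the quadratic remainder, increased by 1 so that one can
   divide by it. *)
pose B := p%:R * (p%:R * `|A|) * (2 * m)^-1 + 1.
have B0 : 0 < B.
  by rewrite ltr_wpDl// mulr_ge0 ?invr_ge0 ?mulr_ge0// ltW.
have small : \forall u \near (0 : 'cV[R]_p), `|u| <= del / 2 / B.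
  apply/nbhs_ballP; exists (del / 2 / B); first exact: divr_gt0.
  by move=> u; rewrite mx_norm_ball /ball_/= add0r normrN => /ltW.
apply: filterS2 (hz _ del2) small => u; rewrite centered_objective_expand//.
set f := h (z + u) - h z; set q := dotp (A *m u) u.
set t := m^-1 *: e - _; rewrite (dotpBl dh t) => Hf uB.
have -> : f - dotp t u + (2 * m)^-1 * q - (dotp dh u - dotp t u) =
   f - dotp dh u + (2 * m)^-1 * q by ring.
rewrite (le_trans (ler_normD _ _))//.
have -> : del * `|u| = del / 2 * `|u| + del / 2 * `|u| by field.
rewrite lerD//.
have -> : `|(2 * m)^-1 * q| = (2 * m)^-1 * `|q|.
  by rewrite normrM gtr0_norm// invr_gt0 mulr_gt0.
have qE : `|q| <= p%:R * (p%:R * `|A|) * `|u| * `|u|.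
  rewrite (le_trans (norm_dotp_le _ _))// !mulrA ler_wpM2r//.
  by rewrite -!mulrA ler_wpM2l// norm_mulmx_le.
apply: (@le_trans _ _ ((B - 1) * `|u| * `|u|)).
  rewrite /B addrK.
  have -> : p%:R * (p%:R * `|A|) / (2 * m) * `|u| * `|u| =
    (2 * m)^-1 * (p%:R * (p%:R * `|A|) * `|u| * `|u|) by ring.
  by rewrite ler_wpM2l// invr_ge0 mulr_ge0// ltW.
rewrite ler_wpM2r//; apply: (@le_trans _ _ (B * `|u|)).
  by rewrite ler_wpM2r// gerBl.
by rewrite mulrC -ler_pdivlMr.
Qed.

Let cobj n := centered_objective J (mu n) (G n) (eps n).

Let ker_T v : in_kernel F x0 v -> model_space J x0 v.
Proof. by move=> v0; exact: (kernel_model_space model Mx0 v0). Qed.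

Let Jeta0 : subdifferential J x0 eta0. Proof. by case: eta0_relint. Qed.

Let GtT : Gt^T = Gt.
Proof.
have GTc : (fun n => (G n)^T) @ \oo --> Gt^T by exact: cvg_trmx.
apply: (@cvg_unique _ (@norm_hausdorff _ _) _ _ _ _ _ GGt).
by have <- : (fun n => (G n)^T) = G by apply/funext => n; rewrite GT.
Qed.

Let Gt_ge0 v : 0 <= dotp (Gt *m v) v.
Proof.
have Gv : (fun n => dotp (G n *m v) v) @ \oo --> dotp (Gt *m v) v.
  apply: cvg_dotp; last exact: cvg_cst.
  by apply: cvg_mulmx => //; exact: cvg_cst.
by apply: cvg_to_ge Gv _; exact: nearW.
Qed.

(** Cutting [M] by the ball on which the equations are valid gives a compact constraint set. *)
Let K : set 'cV[R]_p := [set y | `|y - x0| <= r /\ M y].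

Let K_closed : closed K.
Proof.
have [r0 _ Freg MF _] := model.
have Bcl : closed [set y : 'cV[R]_p | `|y - x0| <= r].
  exact: (compact_closed (@norm_hausdorff _ _) (@compact_cball _ _ x0 r)).
move=> y Ky; have yr : `|y - x0| <= r.
  by apply: Bcl; apply: closure_subset Ky => z [].
split => //; apply/MF => // i; apply: contrapT => Fy.
have [dF _] := Freg y yr.
have : \forall z \near y, F i z != 0.
  apply: (cvgr_neq0 (F := nbhs y) (F i y)); last exact/eqP.
  exact: (differentiable_continuous (dF i)).
move=> /Ky[z [[zr Mz]]]; rewrite (iffLR (MF z zr) Mz) eqxx//.
Qed.

Let K_compact : compact K.
Proof.
apply: (subclosed_compact K_closed (@compact_cball _ _ x0 r)).
by move=> z [].
Qed.

Let minimizer n : exists x, K x /\ forall y, K y -> cobj n x <= cobj n y.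
Proof.
have [r0 _ _ _ gJ] := model.
(* On [K] the functions [J] and [g] coincide, and continuity is read off the differentiable [g]. *)
pose h := centered_objective g (mu n) (G n) (eps n).
have hE y : K y -> h y = cobj n y.
  by move=> [yr My]; rewrite /h /cobj /centered_objective (gJ y yr).2.
have [||x /[!inE] Kx xmin] := @compact_EVT_min _ R h K _ K_compact.
- by exists x0; split => //; rewrite subrr normr0 ltW.
- apply: continuous_in_subspaceT => y /[!inE] -[yr _].
  have yc : (fun z : 'cV[R]_p => z - x0) @ y --> y - x0.
    by apply: (@cvgB _ _ _ (nbhs y)); [exact: cvg_id|exact: cvg_cst].
  apply: (@cvgB _ _ _ (nbhs y)).
    apply: (@cvgD _ _ _ (nbhs y)).
      by apply: differentiable_continuous; exact: (gJ y yr).1.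
    apply: (@cvgM _ _ (nbhs y)); first exact: cvg_cst.
    apply: (@cvg_dotp _ _ (nbhs y)); last exact: yc.
    by apply: (@cvg_mulmx _ _ (nbhs y)); [exact: cvg_cst|exact: yc].
  apply: (@cvgM _ _ (nbhs y)); first exact: cvg_cst.
  by apply: (@cvg_dotp _ _ (nbhs y)); [exact: cvg_cst|exact: yc].
exists x; split => // y Ky; rewrite -!hE//.
by apply: xmin; rewrite inE.
Qed.

Let x n := sval (cid (minimizer n)).
Let xK n : K (x n). Proof. by rewrite /x; case: cid => ? []. Qed.
Let x_min n y : K y -> cobj n (x n) <= cobj n y.
Proof. by rewrite /x; case: cid => ? [? +] /=; exact. Qed.

Let d n := x n - x0.

(** Comparison of [x n] with the competitor [x0]; both the convergence of [x n] and its rate come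
    from this inequality. *)
Let energy n : J (x n) + (2 * mu n)^-1 * dotp (G n *m d n) (d n)
  - dotp ((mu n)^-1 *: eps n) (d n) <= J x0.
Proof.
have Kx0 : K x0.
  by split => //; rewrite subrr normr0; have [/ltW] := model.
have := x_min n Kx0; rewrite /cobj /centered_objective subrr dotp0r !mulr0.
by rewrite dotp0r mulr0 addr0 subr0 -/(d n) dotpZl.
Qed.

Let energy_ge0 n : 0 <= (2 * mu n)^-1 * dotp (G n *m d n) (d n).
Proof. by rewrite mulr_ge0 ?invr_ge0 ?mulr_ge0// ltW. Qed.

Let gJ_lim U z : UltraFilter U -> x @ U --> z -> (fun n => J (x n)) @ U --> J z.
Proof.
move=> UU xz; have [_ _ _ _ gJ] := model.
have [zr Mz] : K z.
  by apply: (closed_cvg _ K_closed) xz; exact: nearW.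
have [dg <-//] := gJ z zr.
have -> : (fun n => J (x n)) = (fun n => g (x n)).
  by apply/funext => n; have [xr Mx] := xK n; rewrite (gJ _ xr).2.
by apply: continuous_cvg => //; exact: differentiable_continuous.
Qed.

Let x_cvg : x @ \oo --> x0.
Proof.
apply: ultra_cvg => U UU ooU.
have [|z xz] := @ultra_bounded_cvg R _ U p x (`|x0| + r).
  apply: nearW => n; have [xr _] := xK n.
  by rewrite -(subrK x0 (x n)) addrC (le_trans (ler_normD _ _))// lerD2l.
have dz : d @ U --> z - x0 by apply: cvgB => //; exact: cvg_cst.
have Jz := gJ_lim UU xz.
have epsU := finer_cvg ooU eps0.
have epsd : (fun n => dotp ((mu n)^-1 *: eps n) (d n)) @ U --> (0 : R).
  by rewrite -(dotp0l (z - x0)); exact: cvg_dotp.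
have Jz_le : J z <= J x0.
  rewrite -subr_ge0; apply: (@cvg_to_ge _ _ U _ (fun n => J x0 - J (x n) +
    dotp ((mu n)^-1 *: eps n) (d n))).
    rewrite -[X in _ --> X]addr0; apply: cvgD => //.
    by apply: cvgB => //; exact: cvg_cst.
  by apply: nearW => n; have := energy n; have := energy_ge0 n; lra.
have Gd : (fun n => dotp (G n *m d n) (d n)) @ U --> dotp (Gt *m (z - x0)) (z - x0).
  exact: (cvg_dotp (cvg_mulmx (finer_cvg ooU GGt) dz) dz).
have muU := finer_cvg ooU mu0.
(* After multiplication of the energy inequality by 2 mu_n, only the quadratic form remains in the
   limit. *)
have Gz : Gt *m (z - x0) = 0.
  apply: psd_form_eq0 => //; apply/eqP; rewrite eq_le Gt_ge0 andbT.
  rewrite -subr_ge0 sub0r.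
  apply: (@cvg_to_ge _ _ U _ (fun n => 2 * mu n * (J x0 - J (x n) +
      dotp ((mu n)^-1 *: eps n) (d n)) - dotp (G n *m d n) (d n))).
    rewrite -[X in _ --> X]add0r; apply: cvgB => //.
    rewrite -(mul0r (J x0 - J z + 0)) -{1}(mulr0 2).
    apply: cvgM; first by apply: cvgM => //; exact: cvg_cst.
    by apply: cvgD => //; apply: cvgB => //; exact: cvg_cst.
  apply: nearW => n; have m2 : 0 < 2 * mu n by rewrite mulr_gt0.
  rewrite subr_ge0 mulrC -ler_pdivrMr// mulrC.
  by have := energy n; lra.
(* [eta0] lies in the range of the symmetric [Gt], which kills [z - x0]. *)
have eta0z : dotp eta0 (z - x0) = 0.
  rewrite /eta0 /precertificate -mulmxA dotp_sym_mulmx//.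
  by rewrite Gz dotp0r.
suff z0 : z - x0 = 0 by move/eqP : z0 xz; rewrite subr_eq0 => /eqP ->.
(* Every subgradient [e] at [x0] has <e, z - x0> <= J z - J x0 <= 0, so [eta0] is maximal in the
   direction [z - x0]. *)
apply: Gt_inj => //; apply: (relint_maximal eta0_relint) => e Je.
by rewrite eta0z; have := Je z; lra.
Qed.

(** * Rate, limit of the dual vectors and global optimality along a fixed ultrafilter *)

Section Ultra.
Variable U : set_system nat.
Hypotheses (UU : UltraFilter U) (ooU : \oo `<=` U).

Let xU : x @ U --> x0. Proof. exact: finer_cvg ooU x_cvg. Qed.

Let dU : d @ U --> (0 : 'cV[R]_p).
Proof. by rewrite -(subrr x0); apply: cvgB => //; exact: cvg_cst. Qed.

Let epsU := finer_cvg ooU eps0.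
Let muU := finer_cvg ooU mu0.
Let GU := finer_cvg ooU GGt.

(** Both [x n] and [x0] are zeros of [F i], so the linear term of the expansion equals its own
    remainder. *)
Let F_expand i e : 0 < e ->
  \forall n \near U, `|dotp (grad (F i) x0) (d n)| <= e * `|d n|.
Proof.
move=> e0; have [r0 _ Freg MF _] := model.
have x0B : `|x0 - x0| <= r by rewrite subrr normr0 ltW.
have [/(_ i) dF _] := Freg x0 x0B.
have F0 y : K y -> F i y = 0 by move=> [yr My]; apply: (iffLR (MF y yr)).
have Fx0 : F i x0 = 0 by apply: F0.
have : \forall n \near U, `|F i (x0 + d n) - F i x0 - dotp (grad (F i) x0) (d n)|
    <= e * `|d n| by exact: dU (differentiable_gradient dF e0).
apply: filterS => n; have -> : x0 + d n = x n by rewrite addrC subrK.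
by rewrite Fx0 F0// subrr sub0r normrN.
Qed.

(* Limits of rescaled secants of M at x0 are tangent to M. *)
Let direction_limit (s : nat -> 'cV[R]_p) (a : nat -> R) b C :
  (forall n, s n = a n *: d n) -> (\forall n \near U, `|s n| <= C) ->
  s @ U --> b -> model_space J x0 b.
Proof.
move=> sE sC sb; apply: ker_T => i; apply/eqP; rewrite -normr_eq0.
have sbi : (fun n => `|dotp (grad (F i) x0) (s n)|) @ U -->
    `|dotp (grad (F i) x0) b|.
  by apply: cvg_norm; exact: (cvg_dotp (cvg_cst _) sb).
rewrite eq_le normr_ge0 andbT; apply/ler_addgt0Pr => e e0; rewrite add0r.
apply: (cvg_to_le sbi).
have C1 : 0 < `|C| + 1 by rewrite ltr_wpDl.
have := F_expand i (divr_gt0 e0 C1); apply: filterS2 sC => n sC dn.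
rewrite sE dotpZr normrM.
apply: (@le_trans _ _ (`|a n| * (e / (`|C| + 1) * `|d n|))).
  by rewrite ler_wpM2l.
rewrite mulrCA -normrZ -sE mulrAC ler_pdivrMr// ler_wpM2l// ?(ltW e0)//.
by rewrite (le_trans sC)// (le_trans (ler_norm _))// lerDl.
Qed.

Let a n := (mu n)^-1 *: d n.

(** The normalized errors tend to a unit vector of the model space, on which the form of [Gt] is
    positive. The quadratic term of [energy] is then at least of order |d|^2 / mu, while the
    subgradient [eta0] and [eps] leave only terms of order |d|. *)
Let a_bounded : exists C, \forall n \near U, `|a n| <= C.
Proof.
(* An ultrafilter decides whether [d n] vanishes; only nonzero errors can be normalized. *)
have [d0|dn0] := ultra_near_or [set n | d n = 0] UU.
  by exists 0; apply: filterS d0 => n d0; rewrite /a d0 scaler0 normr0.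
pose s n := `|d n|^-1 *: d n.
have s1 : \forall n \near U, `|s n| = 1.
  apply: filterS dn0 => n /eqP dn0.
  by rewrite normrZ normfV normr_id mulVf// normr_eq0.
have s_le1 : \forall n \near U, `|s n| <= 1 by apply: filterS s1 => n ->.
have [b sb] := ultra_bounded_cvg UU s_le1.
have b1 : `|b| = 1.
  have nb : (fun n => `|s n|) @ U --> `|b| by exact: cvg_norm.
  by apply/eqP; rewrite eq_le (cvg_to_le nb) ?(cvg_to_ge nb)//;
    apply: filterS s1 => n ->.
have Tb : model_space J x0 b by exact: (direction_limit (fun=> erefl) s_le1 sb).
have kappa0 : 0 < dotp (Gt *m b) b.
  rewrite lt_neqAle Gt_ge0 andbT eq_sym; apply/eqP => /(psd_form_eq0 GtT Gt_ge0).
  by move=> /Gt_inj/(_ Tb) b0; move: b1;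
    rewrite b0 normr0 => /esym/eqP; rewrite oner_eq0.
set kappa := dotp _ _ in kappa0.
have kappa2 : kappa / 2 < kappa by lra.
have Gs : (fun n => dotp (G n *m s n) (s n)) @ U --> kappa.
  exact: (cvg_dotp (cvg_mulmx GU sb) sb).
have Gs_ge := cvgr_ge _ Gs _ kappa2.
have eps1 : \forall n \near U, `|(mu n)^-1 *: eps n| <= 1.
  have /cvgr0_norm_le := epsU; exact.
exists (4 * p%:R * (1 + `|eta0|) / kappa).
near=> n; have dn : d n <> 0 by near: n.
have t0 : 0 < `|d n| by rewrite normr_gt0; exact/eqP.
have Jn : J x0 + dotp eta0 (d n) <= J (x n) by exact: Jeta0.
have quad : (2 * mu n)^-1 * dotp (G n *m d n) (d n) <= p%:R * (1 + `|eta0|) * `|d n|.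
  have H1 : dotp ((mu n)^-1 *: eps n) (d n) <= p%:R * (1 * `|d n|).
    rewrite (le_trans (ler_norm _))// (le_trans (norm_dotp_le _ _))//.
    by rewrite ler_wpM2l// ler_wpM2r//; near: n.
  have H2 : - dotp eta0 (d n) <= p%:R * (`|eta0| * `|d n|).
    rewrite -dotpNl (le_trans (ler_norm _))// (le_trans (norm_dotp_le _ _))//.
    by rewrite normrN.
  by have := energy n; lra.
have ds : d n = `|d n| *: s n by rewrite scalerA mulfV ?scale1r// gt_eqF.
have m0 : 0 < mu n by [].
have sn : kappa / 2 <= dotp (G n *m s n) (s n) by near: n; exact: Gs_ge.
have : (2 * mu n)^-1 * (`|d n| * (`|d n| * (kappa / 2))) <=
    p%:R * (1 + `|eta0|) * `|d n|.
  apply: le_trans quad; rewrite [in leRHS]ds -scalemxAr dotpZl dotpZr.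
  rewrite ler_wpM2l ?invr_ge0 ?mulr_ge0 ?(ltW m0)//.
  by rewrite ler_wpM2l// ler_wpM2l.
have -> : (2 * mu n)^-1 * (`|d n| * (`|d n| * (kappa / 2))) =
    (`|d n| / mu n * (kappa / 4)) * `|d n| by field; rewrite gt_eqF.
rewrite ler_pM2r// => H.
rewrite /a normrZ normfV gtr0_norm// mulrC ler_pdivlMr//.
by lra.
Unshelve. all: by end_near. Qed.

(** Minus the gradient of the data term at [x n]: global optimality of [x n] follows once this is a
    subgradient of [J] there. *)
Let eta n := (mu n)^-1 *: eps n - G n *m a n.

(** Stationarity of [x n] on [M] makes [eta n] act on tangent directions as the gradient of [g], and
    so does every subgradient. *)
Let eta_orth : \forall n \near U, forall zeta v,
  subdifferential J (x n) zeta -> in_kernel F (x n) v ->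
  dotp (eta n - zeta) v = 0.
Proof.
have [r0 _ _ _ gJ] := model.
(* Off the boundary of the ball, only the equations [F] constrain the minimizer. *)
have xr : \forall n \near U, `|x n - x0| < r.
  by move/cvgrPdist_lt : xU => /(_ _ r0); apply: filterS => n; rewrite distrC.
apply: filterS xr => n xr zeta v Jzeta xv.
have [xrw Mx] := xK n; have [dg _] := gJ _ xrw.
rewrite dotpBl (subdifferential_kernel model xr Mx Jzeta xv) -opprB -dotpBl.
apply/eqP; rewrite oppr_eq0; apply/eqP.
have gc := has_gradient_centered (eps n) (GT n) (mu_gt0 n) (differentiable_gradient dg).
rewrite /eta /a -scalemxAr.
apply: (lagrange_eq0 model xr Mx gc _ xv) => y yr My.
have := x_min n (conj yr My).
by rewrite /cobj /centered_objective (gJ _ xrw).2// (gJ _ yr).2.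
Qed.

(* Limits of normal vectors at x n are normal at x0 because their multipliers
   stay bounded. *)
Let normal_limit (b : nat -> 'cV[R]_p) bl :
  (\forall n \near U, forall v, in_kernel F (x n) v -> dotp (b n) v = 0) ->
  b @ U --> bl -> forall v, model_space J x0 v -> dotp bl v = 0.
Proof.
move=> bker bbl v /T_kernel v0; have [r0 c0 Freg _ _] := model.
have dbl : dotp bl bl < dotp bl bl + 1 by rewrite ltrDl.
have b_le := cvgr_lt _ (cvg_dotp bbl bbl) _ dbl.
(* Regularity bounds the square of each multiplier by (|bl|^2 + 1) / c, in the Euclidean norm, and
   |q| <= q^2 + 1. *)
pose L := (dotp bl bl + 1) / c + 1.
have L0 : 0 < L by rewrite ltr_wpDl// divr_ge0 ?addr_ge0 ?dotp_ge0// ltW.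
have [l l0 gv] : exists2 l : R, l = 0 &
    (fun n => L * \sum_i `|dotp (grad (F i) (x n)) v|) @ U --> l.
  exists (L * \sum_i `|dotp (grad (F i) x0) v|).
    by rewrite big1 ?mulr0// => i _; rewrite v0 normr0.
  apply: cvgM; first exact: cvg_cst.
  apply: (cvg_bigsum (f := fun i n => `|dotp (grad (F i) (x n)) v|)) => i.
  apply: cvg_norm; apply: (cvg_dotp (f := fun n => grad (F i) (x n))).
    by apply: (@cvg_comp _ _ _ x (grad (F i)) _ _ _ xU); exact: gradF.
  exact: cvg_cst.
have bv : (fun n => `|dotp (b n) v|) @ U --> `|dotp bl v|.
  by apply: cvg_norm; exact: (cvg_dotp bbl (cvg_cst v)).
apply/eqP; rewrite -normr_eq0 eq_le normr_ge0 andbT.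
rewrite -oppr_ge0 -sub0r -[X in X - _]l0.
apply: (@cvg_to_ge _ _ U _ (fun n => L * \sum_i `|dotp (grad (F i) (x n)) v| -
    `|dotp (b n) v|)); first exact: cvgB.
near=> n; rewrite subr_ge0.
have [_ Fl] := Freg (x n) (xK n).1.
have /orthogonal_kernel_span[q bE] : forall w, in_kernel F (x n) w ->
  dotp (b n) w = 0 by near: n.
have {}Fl := Fl q; rewrite /= -bE in Fl.
have bn : dotp (b n) (b n) < dotp bl bl + 1 by near: n; exact: b_le.
have lL i : `|q i| <= L.
  have li : q i ^+ 2 <= (dotp bl bl + 1) / c.
    rewrite ler_pdivlMr// mulrC (le_trans _ (ltW bn))// (le_trans _ Fl)//.
    rewrite ler_wpM2l ?(ltW c0)// (bigD1 i)//= lerDl sumr_ge0// => j _.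
    exact: sqr_ge0.
  have : 0 <= (`|q i| - 1) ^+ 2 by exact: sqr_ge0.
  have := real_normK (num_real (q i)).
  have q0 : 0 <= `|q i| by [].
  by rewrite /L; nra.
rewrite bE dotpC dotp_sumr mulr_sumr (le_trans (ler_norm_sum _ _ _))//.
by apply: ler_sum => i _; rewrite dotpZr normrM dotpC ler_wpM2r.
Unshelve. all: by end_near. Qed.

(** The limit is - Gt al with [al] in the model space, and its projection there is that of [eta0].
    Injectivity of [Gt] on the model space identifies - al with the vector given by the
    pseudo-inverse. *)
Let eta_cvg : eta @ U --> eta0.
Proof.
have [C aC] := a_bounded; have [al aal] := ultra_bounded_cvg UU aC.
have Tal : model_space J x0 al by exact: (direction_limit (fun=> erefl) aC aal).
have etal : eta @ U --> 0 - Gt *m al 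
  by apply: (@cvgB _ _ _ U); [exact: epsU|exact: (cvg_mulmx GU aal)].
(* Inner semicontinuity lifts [eta0] to subgradients at the [x n], from which [eta n] differs by
   normal vectors. *)
have [zeta [Jzeta zeta_oo]] := J_isc (fun n => (xK n).2) x_cvg Jeta0.
have zetaU := finer_cvg ooU zeta_oo.
have Ebl v : model_space J x0 v -> dotp (0 - Gt *m al - eta0) v = 0.
  have ez : (fun n => eta n - zeta n) @ U --> 0 - Gt *m al - eta0.
    by apply: (@cvgB _ _ _ U); [exact: etal|exact: zetaU].
  apply: (normal_limit _ ez).
  by apply: filterS eta_orth => n H w xw; exact: (H _ _ (Jzeta n) xw).
set P := orth_proj (model_space J x0).
have Pbl : P *m (- (Gt *m al)) = P *m eta0.
  have := orth_proj_eq0 Ebl; rewrite sub0r mulmxBr => /eqP.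
  by rewrite subr_eq0 => /eqP.
(* Subgradients agree on the model space, so the one picked by [xget] has the same projection as
   [eta0]. *)
have eE : model_vector J x0 = P *m eta0.
  have : [set P *m h | h in subdifferential J x0] (model_vector J x0).
    by apply: xgetPex; exists (P *m eta0), eta0.
  case=> h Jh <-; apply/eqP; rewrite -subr_eq0 -mulmxBr; apply/eqP.
  apply: orth_proj_eq0 => t /orthogonal_VecHullP Ht.
  by rewrite dotpBl (Ht _ _ Jh Jeta0) subrr.
have PT : P^T = P by exact: orth_proj_sym.
have PP h : model_space J x0 (P *m h).
  by have [] := orth_projP (VecHull (subdifferential J x0)) h.
have Pid v : model_space J x0 v -> P *m v = v by exact: orth_proj_id.
have [S SE eta0E] : exists2 S, S = P *m Gt *m P &
    eta0 = Gt *m (mppinv S *m model_vector J x0).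
  by exists (restrict_mx (model_space J x0) Gt) => //; rewrite mulmxA.
clearbody P.
have ST : S^T = S by rewrite SE !trmx_mul PT GtT mulmxA.
have [] := mppinvP S; move: (mppinv S) eta0E => B eta0E B1 B2 B3 B4.
pose q := B *m model_vector J x0.
(* Since [B *m S] is symmetric and B S B = B, the vector q equals S B^T q, which lies in the range
   of [P]. *)
have Tq : model_space J x0 q.
  have -> : q = P *m (Gt *m (P *m (B^T *m q))).
    rewrite 3!mulmxA -SE -{1}ST -trmx_mul B4.
    by rewrite /q [RHS]mulmxA B2.
  exact: PP.
have Sal : S *m (- al) = model_vector J x0.
  by rewrite eE -Pbl SE -!mulmxA !mulmxN (Pid al).
have Sq : S *m (q + al) = 0.
  by rewrite mulmxDr /q -Sal !mulmxA B1 mulmxN addrC subrr.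
have Tqa : model_space J x0 (q + al) by exact: orthogonalD.
have qa0 : q + al = 0.
  (* On the model space [S] and [Gt] define the same quadratic form. *)
  apply: Gt_inj => //; apply: psd_form_eq0 => //.
  have : dotp (S *m (q + al)) (q + al) = 0 by rewrite Sq dotp0l.
  by rewrite SE -!mulmxA (Pid (q + al))// !dotp_mulmx trmx_mul PT -mulmxA Pid.
have -> : eta0 = 0 - Gt *m al.
  by rewrite eta0E sub0r -mulmxN; congr (_ *m _); apply/eqP; rewrite -addr_eq0 -/q qa0.
exact: etal.
Qed.

(** Each subgradient at [x0] is a limit of subgradients at the [x n], so [eta0] is maximal in the
    limit direction; unit length keeps that limit nonzero. *)
Let ri_direction (b : nat -> 'cV[R]_p) :
  (\forall n \near U, `|b n| = 1) ->
  (\forall n \near U, forall zeta, subdifferential J (x n) zeta ->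
    dotp (zeta - eta n) (b n) <= 0) ->
  exists bl : 'cV[R]_p, [/\ b @ U --> bl, bl <> 0 & model_space J x0 bl].
Proof.
move=> b1 bJ; have b_le1 : \forall n \near U, `|b n| <= 1.
  by apply: filterS b1 => n ->.
have [bl bbl] := ultra_bounded_cvg UU b_le1; exists bl; split=> //.
  move=> bl0; have nb : (fun n => `|b n|) @ U --> `|bl| by exact: cvg_norm.
  have : 1 <= `|bl| by apply: (cvg_to_ge nb); apply: filterS b1 => n ->.
  by rewrite bl0 normr0 ler10.
apply: (relint_maximal eta0_relint) => e Je.
have [zeta [Jzeta zeta_oo]] := J_isc (fun n => (xK n).2) x_cvg Je.
have zetaU := finer_cvg ooU zeta_oo.
rewrite -subr_le0 -dotpBl.
apply: (@cvg_to_le _ _ U _ (fun n => dotp (zeta n - eta n) (b n))).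
  apply: cvg_dotp; last exact: bbl.
  by apply: (@cvgB _ _ _ U); [exact: zetaU|exact: eta_cvg].
by apply: filterS bJ => n; exact.
Qed.

Let eta_subdifferential : \forall n \near U, subdifferential J (x n) (eta n).
Proof.
have [//|bad] := ultra_near_or [set n | subdifferential J (x n) (eta n)] UU.
pose Q n := [set b : 'cV[R]_p | [/\ `|b| = 1,
  forall v, in_kernel F (x n) v -> dotp b v = 0 &
  forall zeta, subdifferential J (x n) zeta -> dotp (zeta - eta n) b <= 0]].
(* The default 0 is returned only on indices that [U] neglects. *)
have Qex : \forall n \near U, Q n (xget 0 (Q n)).
  apply: filterS2 eta_orth bad => n orth bad; apply: xgetPex.
  have [z zlt] : exists z, J z < J (x n) + dotp (eta n) (z - x n).
    apply: contrapT => nz; apply: bad => z; rewrite leNgt; apply/negP => zlt.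
    by apply: nz; exists z.
  pose N : set 'cV[R]_p := [set u | exists i, u = grad (F i) (x n)].
  have NE v : orthogonal N v <-> in_kernel F (x n) v.
    split=> [Nv i|nv _ [i ->]]; last by rewrite dotpC nv.
    by rewrite dotpC; apply: Nv; exists i.
  set w := z - x n in zlt.
  (* [u] is the tangent part of the violating direction. Differences [zeta - eta n] vanish on it, so
     the normal part [w - u] still violates. *)
  have [Pw wP] := orth_projP N w; set u := _ *m w in Pw wP.
  have bJ zeta : subdifferential J (x n) zeta -> dotp (zeta - eta n) (w - u) < 0.
    move=> Jz; have zu : dotp (zeta - eta n) u = 0.
      rewrite -opprB dotpNl (orth _ _ Jz) ?oppr0//.
      by apply/NE; exact: Pw.
    rewrite dotpBr zu subr0 dotpBl.
    by have := Jz z; rewrite -/w; lra.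
  have [zeta0 Jzeta0] : exists zeta, subdifferential J (x n) zeta.
    have [zeta [Jzeta _]] := J_isc (fun n => (xK n).2) x_cvg Jeta0.
    by exists (zeta n).
  have wu0 : 0 < `|w - u|.
    rewrite normr_gt0; apply/eqP => wu; have := bJ _ Jzeta0.
    by rewrite wu dotp0r ltxx.
  exists (`|w - u|^-1 *: (w - u)); split.
  - by rewrite normrZ normfV normr_id mulVf// gt_eqF.
  - by move=> v /NE/wP wuv; rewrite dotpZl wuv mulr0.
  - move=> zeta /bJ b_lt; rewrite dotpZr.
    by rewrite pmulr_rle0 ?invr_gt0// ltW.
have [||bl [bbl bl0 Tbl]] := @ri_direction (fun n => xget 0 (Q n)).
- by apply: filterS Qex => n [].
- by apply: filterS Qex => n [].
(* The limit belongs to the model space and is orthogonal to it. *)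
exfalso; apply: bl0; apply: dotp_eq0; apply: (normal_limit _ bbl Tbl).
by apply: filterS Qex => n [].
Qed.

(** Once [eta n] is a subgradient, the gap to [x n] is a sum of two nonnegative terms: the excess of
    [J] over its affine minorant and the quadratic form. Competitors without positive gap have limit
    directions in the model space and in the kernel of [Gt]. *)
Lemma strict_minimizer_ultra : \forall n \near U, exists y, M y /\
  forall z, z <> y -> cobj n y < cobj n z.
Proof.
have [//|bad] := ultra_near_or [set n | exists y, M y /\
  forall z, z <> y -> cobj n y < cobj n z] UU.
pose Q n := [set b : 'cV[R]_p | [/\ `|b| = 1, dotp (G n *m b) b <= 0 &
  forall zeta, subdifferential J (x n) zeta -> dotp (zeta - eta n) b <= 0]].
have Qex : \forall n \near U, Q n (xget 0 (Q n)).
  apply: filterS2 eta_subdifferential bad => n Jeta bad; apply: xgetPex.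
  have [z [zx zle]] : exists z, z <> x n /\ cobj n z <= cobj n (x n).
    apply: contrapT => nz; apply: bad; exists (x n); split; first by case: (xK n).
    move=> z zx; rewrite ltNge; apply/negP => zle.
    by apply: nz; exists z.
  set w := z - x n.
  have w0 : 0 < `|w| by rewrite normr_gt0 subr_eq0; exact/eqP.
  have m2 : 0 < (2 * mu n)^-1 by rewrite invr_gt0 mulr_gt0.
  have := centered_objective_expand J (mu n) (eps n) (x n) w (GT n).
  have -> : x n + w = z by rewrite addrC subrK.
  rewrite -/(cobj n) -/(d n).
  have -> : (mu n)^-1 *: eps n - (mu n)^-1 *: (G n *m d n) = eta n.
    by rewrite /eta /a scalemxAr.
  move=> expand.
  have Jz : J (x n) + dotp (eta n) w <= J z by exact: Jeta.
  have Gw : 0 <= (2 * mu n)^-1 * dotp (G n *m w) w by rewrite mulr_ge0// ltW.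
  exists (`|w|^-1 *: w); split.
  - by rewrite normrZ normfV normr_id mulVf// gt_eqF.
  - rewrite -scalemxAr dotpZl dotpZr !pmulr_rle0 ?invr_gt0//.
    by rewrite -(pmulr_rle0 _ m2); lra.
  - move=> zeta Jzeta; rewrite dotpZr pmulr_rle0 ?invr_gt0// dotpBl.
    by have := Jzeta z; rewrite -/w; lra.
have [||bl [bbl bl0 Tbl]] := @ri_direction (fun n => xget 0 (Q n)).
- by apply: filterS Qex => n [].
- by apply: filterS Qex => n [].
exfalso; apply: bl0; apply: Gt_inj => //; apply: psd_form_eq0 => //.
apply/eqP; rewrite eq_le Gt_ge0 andbT.
apply: (cvg_to_le (cvg_dotp (cvg_mulmx GU bbl) bbl)).
by apply: filterS Qex => n [].
Qed.

End Ultra.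

Lemma strict_minimizer_near : \forall n \near \oo, exists y, M y /\
  forall z, z <> y -> centered_objective J (mu n) (G n) (eps n) y <
    centered_objective J (mu n) (G n) (eps n) z.
Proof. by apply: ultra_near => U UU ooU; exact: strict_minimizer_ultra. Qed.

End Core.

(** * Stable identification *)

Section Stability.
Context {R : realType} {p : nat}.
Implicit Types (J : 'cV[R]_p -> R) (M : set 'cV[R]_p) (z : 'cV[R]_p).

Lemma harmonic_cvg (V : normedModType R) (f : nat -> V) (l : V) :
  (forall n, `|f n - l| <= harmonic n) -> f @ \oo --> l.
Proof.
move=> fl; apply/cvgrPdist_le => e e0.
have := @cvg_harmonic R; move/cvgrPdist_le => /(_ e e0).
apply: filterS => n; rewrite sub0r normrN ger0_norm ?harmonic_ge0// => he.
by rewrite distrC (le_trans (fl n)).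
Qed.

(** If no threshold worked, failures at the thresholds [harmonic n] would form a sequence of
    problems to which [strict_minimizer_near] applies. *)
Lemma stable_strict_minimizer J M (x0 : 'cV[R]_p) (Gt : 'M[R]_p) :
  partly_smooth J M x0 ->
  (forall v, Gt *m v = 0 -> model_space J x0 v -> v = 0) ->
  relint (subdifferential J x0) (precertificate J x0 Gt) ->
  exists2 del : R, 0 < del & forall m (A : 'M[R]_p) e,
    0 < m -> m < del -> A^T = A -> (forall v, 0 <= dotp (A *m v) v) ->
    `|A - Gt| < del -> `|e| < del * m ->
    exists y, M y /\ forall z, z <> y ->
      centered_objective x0 J m A e y < centered_objective x0 J m A e z.
Proof.
move=> [Mx0 JC2 tangent [Jisc _]] Gt_inj eta_ri; apply: contrapT => nodel.
have [k [F [g [r [c [model gradF]]]]]] := local_model_ex Mx0 JC2.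
have [r0 _ Freg MF _] := model.
have M0 : M x0 by case: Mx0.
have x0B : `|x0 - x0| <= r by rewrite subrr normr0 ltW.
have T_ker v : model_space J x0 v -> in_kernel F x0 v.
  rewrite -tangent => Tv i; have [/(_ i) dF _] := Freg x0 x0B.
  by apply: (tangent_space_grad r0 dF _ Tv) => y yr /MF; exact.
pose bad n (q : R * 'M[R]_p * 'cV[R]_p) :=
  [/\ [/\ 0 < q.1.1, q.1.1 < harmonic n, q.1.2^T = q.1.2 &
      forall v, 0 <= dotp (q.1.2 *m v) v],
    `|q.1.2 - Gt| < harmonic n, `|q.2| < harmonic n * q.1.1 &
    ~ exists y, M y /\ forall z, z <> y ->
      centered_objective x0 J q.1.1 q.1.2 q.2 y <
      centered_objective x0 J q.1.1 q.1.2 q.2 z].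
have /choice[q qbad] n : exists q, bad n q.
  apply: contrapT => nq; apply: nodel; exists (harmonic n); first exact: harmonic_gt0.
  move=> m A e m0 mn AT A0 An en; apply: contrapT => nmin.
  by apply: nq; exists (m, A, e).
have mu0 n : 0 < (q n).1.1 by have [[]] := qbad n.
have [||||||n _ /(_ n (leqnn n))] := strict_minimizer_near M0 model gradF T_ker Jisc
  Gt_inj eta_ri (mu := fun n => (q n).1.1) (G := fun n => (q n).1.2)
  (eps := fun n => (q n).2).
- by [].
- apply: harmonic_cvg => n; rewrite subr0 gtr0_norm// ltW//.
  by have [[]] := qbad n.
- by move=> n; have [[]] := qbad n.
- by move=> n; have [[]] := qbad n.
- by apply: harmonic_cvg => n; rewrite ltW//; have [] := qbad n.
- apply: harmonic_cvg => n; rewrite subr0 normrZ normfV gtr0_norm//.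
  by rewrite ler_pdivrMl// mulrC ltW//; have [] := qbad n.
by have [_ _ _] := qbad n.
Qed.

(** Completing the square at [x0]; the pseudo-inverse term does not depend on [z] and goes into the
    constant. *)
Lemma objective_centered J (x0 : 'cV[R]_p) m (A : 'M[R]_p) e : A^T = A ->
  exists K, forall z,
    objective J m (A *m x0 + e) A z = centered_objective x0 J m A e z + K.
Proof.
move=> AT; set u := A *m x0 + e.
exists ((2 * m)^-1 * dotp (mppinv A *m u) u - (2 * m)^-1 * dotp (A *m x0) x0
  - m^-1 * dotp e x0) => z.
rewrite /objective /centered_objective -/u.
move: (dotp (mppinv A *m u) u) => K0.
rewrite /u mulmxBr !(dotpDr, dotpNr, dotpBl).
rewrite [dotp (A *m x0) z]dotp_sym_mulmx// (dotpC x0) (dotpC z e).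
rewrite [dotp z (A *m x0)]dotpC [dotp (A *m x0) z]dotp_sym_mulmx// (dotpC x0).
by rewrite invfM; move: (m^-1) => i; field.
Qed.

Lemma strict_minimizer_solution J M (x0 : 'cV[R]_p) m (A : 'M[R]_p) e y :
  A^T = A -> M y ->
  (forall z, z <> y ->
    centered_objective x0 J m A e y < centered_objective x0 J m A e z) ->
  solutions J m (A *m x0 + e) A !=set0 /\
  solutions J m (A *m x0 + e) A `<=` M.
Proof.
move=> AT My ymin; have [K objE] := objective_centered J x0 m e AT.
split.
  exists y => z; rewrite !objE lerD2r.
  by have [->//|/eqP zy] := eqVneq z y; exact/ltW/ymin.
move=> s ssol; have [<-//|/eqP sy] := eqVneq y s.
have := ssol y; rewrite !objE lerD2r leNgt ymin//.
by move=> /esym; exact: sy.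
Qed.

(** Local equations make [M] locally closed: it is the intersection of its closure with the open set
    [W]. *)
Lemma C2_manifold_borel M : C2_manifold M -> measurable (M : set (borel 'cV[R]_p)).
Proof.
move=> manM.
pose W : set 'cV[R]_p := [set y | exists U : set 'cV[R]_p,
  [/\ open U, U y & closure M `&` U `<=` M]].
have oW : open W.
  rewrite openE => y [U [oU Uy UM]].
  have : nbhs y U by exact: open_nbhs_nbhs.
  by apply: filterS => z Uz; exists U.
have -> : M = closure M `&` W.
  apply/seteqP; split => [x Mx|x [clx [U [_ Ux UM]]]]; last exact: UM.
  split; first exact: subset_closure.
  have [_ [U [k [F [[oU Ux] FC2 MU _]]]]] := manM x Mx.
  exists U; split => // y [cly Uy].
  suff : (M `&` U) y by case.
  rewrite MU; split => // i; apply: contrapT => Fy.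
  have [FC1 _] := FC2 i; have [dF _] := FC1 y Uy.
  have Fny : \forall z \near y, F i z != 0.
    apply: (cvgr_neq0 (F := nbhs y) (F i y)); last exact/eqP.
    exact: (differentiable_continuous dF).
  have /cly[z [Mz [Fz Uz]]] : nbhs y [set z | F i z != 0 /\ U z].
    by apply: filterI => //; exact: open_nbhs_nbhs.
  have : (M `&` U) z by [].
  by rewrite MU => -[_ /(_ i) Fz0]; rewrite Fz0 eqxx in Fz.
apply: measurableI; last exact: sub_sigma_algebra.
rewrite -[closure M]setCK; apply: measurableC; apply: sub_sigma_algebra.
exact: closed_openC (@closed_closure _ M).
Qed.

End Stability.

(** * Second moments of i.i.d. samples *)

Section SecondMoments.
Local Open Scope ereal_scope.
Context {R : realType} {d : measure_display} {Omega : measurableType d}.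
Variable P : probability Omega R.
Implicit Types X Y : Omega -> R.

Lemma integrable_mul X Y : measurable_fun setT X -> measurable_fun setT Y ->
  P.-integrable setT (fun t => (X t ^+ 2)%:E) ->
  P.-integrable setT (fun t => (Y t ^+ 2)%:E) ->
  P.-integrable setT (fun t => (X t * Y t)%:E).
Proof.
move=> mX mY iX iY.
apply: (le_integrable measurableT _ _ (integrableD measurableT iX iY)).
  by apply/measurable_EFinP; exact: measurable_funM.
move=> t _; rewrite -EFinD !abse_EFin lee_fin.
rewrite [leRHS]ger0_norm ?addr_ge0 ?sqr_ge0// ler_norml.
have := sqr_ge0 (X t); have := sqr_ge0 (Y t).
have := sqr_ge0 (X t + Y t)%R; have := sqr_ge0 (X t - Y t)%R.
by rewrite sqrrB sqrrD; lra.
Qed.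

Lemma integrable_sqr_integrable X : measurable_fun setT X ->
  P.-integrable setT (fun t => (X t ^+ 2)%:E) ->
  P.-integrable setT (EFin \o X).
Proof.
move=> mX iX; have i1 : P.-integrable setT (fun=> (1%R ^+ 2)%:E).
  exact: finite_measure_integrable_cst.
have := integrable_mul mX (@measurable_cst _ _ _ R setT (1%R : R)) iX i1.
by apply: eq_integrable => // t _; rewrite mulr1.
Qed.

(** Independence identifies the law of the pair with the product of the laws, and Fubini integrates
    in [y] first. *)
Lemma integral_mul_indep X Y : measurable_fun setT X -> measurable_fun setT Y ->
  (forall A B, measurable A -> measurable B ->
    P (X @^-1` A `&` Y @^-1` B) = P (X @^-1` A) * P (Y @^-1` B)) ->
  P.-integrable setT (fun t => (X t * Y t)%:E) ->
  P.-integrable setT (EFin \o Y) -> \int[P]_t (Y t)%:E = 0 ->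
  \int[P]_t (X t * Y t)%:E = 0.
Proof.
move=> mX mY XY_indep iXY iY Y0.
pose X' : {mfun Omega >-> R} := HB.pack X (isMeasurableFun.Build _ _ _ _ X mX).
pose Y' : {mfun Omega >-> R} := HB.pack Y (isMeasurableFun.Build _ _ _ _ Y mY).
pose Z t := (X t, Y t).
have mZ : measurable_fun setT Z by exact: measurable_fun_pair.
pose Z' : {mfun Omega >-> (R * R)%type} :=
  HB.pack Z (isMeasurableFun.Build _ _ _ _ Z mZ).
pose f (z : R * R) := (z.1 * z.2)%:E.
have mf : measurable_fun setT f.
  by apply/measurable_EFinP; apply: measurable_funM.
have EZ A : measurable A ->
    (distribution P X' \x distribution P Y') A = distribution P Z' A.
  by apply: product_measure_unique => B C mB mC; exact: XY_indep.
have -> : \int[P]_t (X t * Y t)%:E = \int[distribution P Z']_z f z.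
  by rewrite integral_distribution.
rewrite (eq_measure_integral (distribution P X' \x distribution P Y')); last first.
  by move=> A mA _; exact/esym/EZ.
have iZ : (distribution P Z').-integrable setT f by exact: integrable_pushforward.
rewrite -integral12_prod_meas1; last first.
  apply/integrableP; split => //.
  rewrite (eq_measure_integral (distribution P Z')); last first.
    by move=> A mA _; exact: EZ.
  by have /integrableP[] := iZ.
rewrite integral0_eq// => x _; rewrite /fubini_F /f/=.
under eq_integral do rewrite EFinM.
rewrite integralZl//.
  by rewrite integral_distribution//= Y0 mule0.
exact: integrable_pushforward.
Qed.

Lemma markov_sqr X (a : R) : measurable_fun setT X -> (0 < a)%R ->
  P [set t | (a <= `|X t|)%R] * (a ^+ 2)%:E <= \int[P]_t (X t ^+ 2)%:E.
Proof.
move=> mX a0; rewrite muleC.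
pose X' : {mfun Omega >-> R} := HB.pack X (isMeasurableFun.Build _ _ _ _ X mX).
have := @markov _ _ _ P X' (fun r => r ^+ 2)%R a a0.
rewrite unlock /= => H; apply: le_trans (H _ _ _) _.
- by apply: measurable_funX.
- by move=> r _; exact: sqr_ge0.
- by move=> x y x0 y0 xy; rewrite lerXn2r.
- by under eq_integral do rewrite real_normK ?num_real//.
Qed.

Section Iid.
Context {d' : measure_display} {T : measurableType d'}.
Variable Z : nat -> Omega -> T.
Hypothesis Ziid : iid P Z.
Variable f : T -> R.
Hypothesis mf : measurable_fun setT f.

Let mZ i : measurable_fun setT (Z i). Proof. by case: Ziid. Qed.

Lemma iid_measurable i : measurable_fun setT (fun t => f (Z i t)).
Proof. exact: measurableT_comp. Qed.

Let RVZ i : {mfun Omega >-> T} :=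
  HB.pack (Z i) (isMeasurableFun.Build _ _ _ _ (Z i) (mZ i)).

Let distribution_eq i A : measurable A ->
  distribution P (RVZ i) A = distribution P (RVZ 0%N) A.
Proof. by move=> mA; have [_ _ /(_ i 0%N A mA)] := Ziid. Qed.

Lemma iid_ge0_integral (g : T -> \bar R) i : measurable_fun setT g ->
  (forall z, 0 <= g z) -> \int[P]_t g (Z i t) = \int[P]_t g (Z 0%N t).
Proof.
move=> mg g0.
rewrite -(ge0_integral_distribution (RVZ i) mg g0).
rewrite -(ge0_integral_distribution (RVZ 0%N) mg g0).
by apply: eq_measure_integral => A mA _; exact: distribution_eq.
Qed.

Lemma iid_integrable i : P.-integrable setT (fun t => (f (Z 0%N t))%:E) ->
  P.-integrable setT (fun t => (f (Z i t))%:E).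
Proof.
move=> /integrableP[_ if0]; apply/integrableP; split.
  by apply/measurable_EFinP; exact: iid_measurable.
rewrite (iid_ge0_integral (g := fun z => `|(f z)%:E|))//.
by apply: measurableT_comp => //; exact/measurable_EFinP.
Qed.

Lemma iid_integral i : P.-integrable setT (fun t => (f (Z 0%N t))%:E) ->
  \int[P]_t (f (Z i t))%:E = \int[P]_t (f (Z 0%N t))%:E.
Proof.
move=> if0; have mEf : measurable_fun setT (EFin \o f) by exact/measurable_EFinP.
rewrite -(integral_distribution (X := RVZ i) mEf (iid_integrable i if0)).
rewrite -(integral_distribution (X := RVZ 0%N) mEf if0).
by apply: eq_measure_integral => A mA _; exact: distribution_eq.
Qed.

End Iid.

(** * Chebyshev bound for sums of centred i.i.d. variables *)

Section WeakLaw.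
Context {d' : measure_display} {T : measurableType d'}.
Variable Z : nat -> Omega -> T.
Hypothesis Ziid : iid P Z.
Variable f : T -> R.
Hypothesis mf : measurable_fun setT f.
Hypothesis f2 : P.-integrable setT (fun t => (f (Z 0%N t) ^+ 2)%:E).
Hypothesis f0 : \int[P]_t (f (Z 0%N t))%:E = 0.

Let mfZ i : measurable_fun setT (fun t => f (Z i t)).
Proof. exact: (iid_measurable Ziid mf). Qed.

Let mf2 : measurable_fun setT (fun z => f z ^+ 2)%R.
Proof. exact: measurable_funX. Qed.

Let if2 i : P.-integrable setT (fun t => (f (Z i t) ^+ 2)%:E).
Proof. exact: (iid_integrable Ziid mf2 i f2). Qed.

Let s2 := fine (\int[P]_t (f (Z 0%N t) ^+ 2)%:E).

Let iid_mul i j : \int[P]_t (f (Z i t) * f (Z j t))%:E =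
  ((i == j)%:R * s2)%:E.
Proof.
have if1 k : P.-integrable setT (EFin \o (fun t => f (Z k t))).
  exact: integrable_sqr_integrable.
have [->|ij] := eqVneq i j.
  rewrite mul1r fineK; last exact: (integrable_fin_num measurableT f2).
  under eq_integral do rewrite -expr2.
  exact: (iid_integral Ziid mf2 _ f2).
rewrite mul0r; apply: integral_mul_indep => //; last first.
- by rewrite (iid_integral Ziid mf)//; exact: (if1 0%N).
- exact: integrable_mul.
move=> A B mA mB; have [_ Zind _] := Ziid.
(* Independence speaks of a whole family of events; only the indices [i] and [j] enter the
   intersection. *)
pose C k := if k == i then f @^-1` A else f @^-1` B.
have mC k : measurable (C k).
  by rewrite /C; case: ifP => _; rewrite -[X in measurable X]setTI; exact: mf.
have := Zind [fset i; j]%fset C mC.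
rewrite big_fsetU1/= ?inE// big_seq_fset1 /C eqxx (negPf (_ : j != i)); last first.
  by rewrite eq_sym.
move=> <-; congr (P _); apply/seteqP; split => [t [At Bt] k /=|t H].
  by rewrite !inE => /orP[|] /eqP ->; rewrite ?eqxx// eq_sym (negPf ij).
split.
  by have := H i; rewrite /= !inE eqxx/=; exact.
by have := H j; rewrite /= !inE eqxx orbT eq_sym (negPf ij); exact.
Qed.

(** Markov's inequality for the square of the sum, whose cross terms integrate to zero. *)
Lemma iid_sum_bound n (a : R) : (0 < a)%R ->
  P [set t | (a <= `|\sum_(i < n) f (Z i t)|)%R] * (a ^+ 2)%:E <=
  (n%:R * s2)%:E.
Proof.
move=> a0; apply: le_trans (markov_sqr _ a0) _.
  by apply: measurable_sum.
have sqE t : ((\sum_(i < n) f (Z i t)) ^+ 2)%:E =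
    \sum_(i < n) \sum_(j < n) (f (Z i t) * f (Z j t))%:E.
  rewrite expr2 big_distrlr/= -sumEFin; apply: eq_bigr => i _.
  by rewrite sumEFin.
under eq_integral do rewrite sqE.
have ifij i j : P.-integrable setT (fun t => (f (Z i t) * f (Z j t))%:E).
  exact: integrable_mul.
rewrite integral_sum//; last by move=> i; apply: integrable_sum => // j _; exact: ifij.
rewrite (eq_bigr (fun=> s2%:E)) => [|i _].
  by rewrite sumEFin sumr_const card_ord mulr_natl.
rewrite integral_sum//.
under eq_bigr do rewrite iid_mul.
rewrite sumEFin (bigD1 i)//= eqxx mul1r big1 ?addr0// => j ji.
by rewrite (_ : (i == j :> nat) = false) ?mul0r// eq_sym; exact/negbTE.
Qed.

End WeakLaw.

End SecondMoments.

(** * Conditionally centered variables *)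

Section ConditionallyCentered.
Import HBSimple HBNNSimple.
Local Open Scope ereal_scope.
Context {R : realType} {d d' : measure_display}.
Context {Omega : measurableType d} {T : measurableType d'}.
Variable P : probability Omega R.
Variables (V : Omega -> T) (w : Omega -> R).
Hypothesis mV : measurable_fun setT V.
Hypothesis iw : P.-integrable setT (EFin \o w).
Hypothesis w_centered : forall B, measurable B ->
  \int[P]_(t in V @^-1` B) (w t)%:E = 0.

Let mw : measurable_fun setT w.
Proof. by case/integrableP : iw => /measurable_EFinP. Qed.

Let mVB B : measurable B -> measurable (V @^-1` B).
Proof. by move=> mB; rewrite -[X in measurable X]setTI; exact: mV. Qed.

(** A simple function is a combination of indicators of its level sets, and [w] has zero integral
    over the preimage of each. *)
Let sfun_mul (h : {nnsfun T >-> R}) : \int[P]_t (h (V t) * w t)%:E = 0.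
Proof.
pose s := fset_set (range h).
pose A (i : nat) := V @^-1` (h @^-1` [set s`_i]).
have mA i : measurable (A i) by apply: mVB; exact: measurable_sfunP.
have iAw i : P.-integrable setT (fun t => (\1_(A i) t)%:E * (w t)%:E).
  apply: (le_integrable measurableT _ _ iw).
    apply: emeasurable_funM; last exact/measurable_EFinP.
    by apply/measurable_EFinP; exact: measurable_indic.
  move=> t _; rewrite -EFinM lee_fin normrM ler_piMl// indicE.
  by case: (t \in A i); rewrite ?normr1 ?normr0.
have hE t : (h (V t) * w t)%:E =
    \sum_(i < #|` s|) (s`_i)%:E * ((\1_(A i) t)%:E * (w t)%:E).
  rewrite (fimfunEord h) -/s big_distrl/= -sumEFin; apply: eq_bigr => i _.
  by rewrite -mulrA EFinM EFinM.
under eq_integral do rewrite hE.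
rewrite integral_sum => [|//|i]; last exact: integrableZl.
apply: big1 => i _; rewrite integralZl//.
rewrite (_ : \int[P]_t _ = \int[P]_(t in A i) (w t)%:E).
  rewrite w_centered ?mule0//; exact: measurable_sfunP.
rewrite [RHS]integral_mkcond; apply: eq_integral => t _.
by rewrite patchE indicE; case: (t \in A i); rewrite ?mul1e ?mul0e.
Qed.

(** Simple functions increase to [g], and the products with [w] are dominated by |g(V) w|. *)
Let ge0_mul (g : T -> R) : measurable_fun setT g -> (forall z, (0 <= g z)%R) ->
  P.-integrable setT (fun t => (g (V t) * w t)%:E) ->
  \int[P]_t (g (V t) * w t)%:E = 0.
Proof.
move=> mg g0 igw.
have mEg : measurable_fun setT (EFin \o g) by exact/measurable_EFinP.
have [h [h_nd hg]] := approximation measurableT mEg (fun t _ => g0 t).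
have hg' z : (fun n => h n z) @ \oo --> g z by have /fine_cvg := hg z I.
have h_le n z : (h n z <= g z)%R.
  rewrite -(cvg_lim (@Rhausdorff R) (hg' z)).
  apply: nondecreasing_cvgn_le; last by apply/cvg_ex; exists (g z).
  by move=> a b ab; exact/lefP/h_nd.
have mh n : measurable_fun setT (fun t => (h n (V t) * w t)%:E).
  apply/measurable_EFinP; apply: measurable_funM => //.
  by apply: measurableT_comp => //; exact: measurable_funPT.
have [||_ _ dcvg] := dominated_convergence measurableT mh
  (measurable_int _ igw) _ (integrable_abse igw) _.
- apply/aeW => t _; apply: cvg_EFin; first exact: nearW.
  by apply: cvgM; [exact: hg'|exact: cvg_cst].
- apply/aeW => t n _; rewrite lee_fin !normrM ler_wpM2r//.
  by rewrite !ger0_norm.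
apply/esym; apply: (cvg_unique _ _ dcvg) => //.
rewrite (_ : [sequence _]_n = cst 0); first exact: cvg_cst.
by apply/funext => n; exact: sfun_mul.
Qed.

Lemma integral_mul_centered (g : T -> R) : measurable_fun setT g ->
  P.-integrable setT (fun t => (g (V t) * w t)%:E) ->
  \int[P]_t (g (V t) * w t)%:E = 0.
Proof.
move=> mg igw.
pose gp z := Num.max (g z) 0%R; pose gn z := Num.max (- g z)%R 0%R.
have mp : measurable_fun setT gp by exact: measurable_maxr.
have mn : measurable_fun setT gn.
  by apply: measurable_maxr => //; exact: measurable_funN.
have gE z : g z = (gp z - gn z)%R.
  by rewrite /gp /gn /Num.max; case: ltP => h1; case: ltP => h2; lra.
have small (k : T -> R) : measurable_fun setT k ->
    (forall z, (`|k z| <= `|g z|)%R) ->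
    P.-integrable setT (fun t => (k (V t) * w t)%:E).
  move=> mk kg; apply: (le_integrable measurableT _ _ igw).
    apply/measurable_EFinP; apply: measurable_funM => //.
    exact: measurableT_comp.
  by move=> t _; rewrite lee_fin !normrM ler_wpM2r.
have ip : P.-integrable setT (fun t => (gp (V t) * w t)%:E).
  apply: small => // z; rewrite /gp /Num.max; case: ltP => // _.
  by rewrite normr0.
have inn : P.-integrable setT (fun t => (gn (V t) * w t)%:E).
  apply: small => // z; rewrite /gn /Num.max; case: ltP => // _.
    by rewrite normr0.
  by rewrite normrN.
under eq_integral do rewrite gE mulrBl EFinB.
rewrite integralB// !ge0_mul ?subee// => z.
  by rewrite /gn le_max lexx orbT.
by rewrite /gp le_max lexx orbT.
Qed.

End ConditionallyCentered.

(** * Empirical moments *)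

Section Assembly.
Context {R : realType}.

Lemma measurable_coord m n (i : 'I_m) (j : 'I_n) :
  measurable_fun setT (fun A : borel 'M[R]_(m, n) => A i j).
Proof.
apply: (measurability (RGenOpens.G (R := R))); first exact: RGenOpens.measurableE.
move=> _ [_ [a [b ->]] <-]; rewrite setTI; apply: sub_sigma_algebra.
apply: (@open_comp 'M[R]_(m, n) R (fun A => A i j)); last exact: interval_open.
by move=> A _; exact: coord_continuous.
Qed.

Lemma probability_bigsetU_le d (Omega : measurableType d) (P : probability Omega R)
    (I : Type) (r : seq I) (E : I -> set Omega) (b : I -> R) :
  (forall i, measurable (E i)) -> (forall i, P (E i) <= (b i)%:E)%E ->
  (P (\big[setU/set0]_(i <- r) E i) <= (\sum_(i <- r) b i)%:E)%E.
Proof.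
move=> mE Eb; elim: r => [|i r IH]; first by rewrite !big_nil measure0.
rewrite !big_cons EFinD; apply: le_trans (leeD (Eb i) IH).
by apply: measureU2 => //; exact: bigsetU_measurable.
Qed.

Context {p : nat} {Omega : Type} (xi : nat -> Omega -> 'rV[R]_p).
Context (w : nat -> Omega -> R) (x0 : 'cV[R]_p).

Definition emp_noise n omega : 'cV[R]_p :=
  n%:R^-1 *: ((design xi n omega)^T *m noise w n omega).

Lemma emp_corrE n omega :
  emp_corr xi w x0 n omega = emp_cov xi n omega *m x0 + emp_noise n omega.
Proof.
by rewrite /emp_corr /emp_cov /emp_noise /observation mulmxDr scalerDr
  -scalemxAl mulmxA.
Qed.

Lemma emp_cov_sym n omega : (emp_cov xi n omega)^T = emp_cov xi n omega.
Proof. by rewrite /emp_cov linearZ/= trmx_mul trmxK. Qed.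

Lemma emp_cov_ge0 n omega v : 0 <= dotp (emp_cov xi n omega *m v) v.
Proof.
rewrite /emp_cov -scalemxAl dotpZl mulr_ge0 ?invr_ge0//.
set D := design xi n omega.
suff -> : dotp (D^T *m D *m v) v = dotp (D *m v) (D *m v) by exact: dotp_ge0.
by rewrite !dotp_mulmx !trmx_mul trmxK !mulmxA.
Qed.

Lemma emp_covE n omega j k :
  emp_cov xi n omega j k = n%:R^-1 * \sum_(i < n) xi i omega 0 j * xi i omega 0 k.
Proof. by rewrite !mxE; congr (_ * _); apply: eq_bigr => i _; rewrite !mxE. Qed.

Lemma emp_noiseE n omega j :
  emp_noise n omega j 0 = n%:R^-1 * \sum_(i < n) xi i omega 0 j * w i omega.
Proof. by rewrite !mxE; congr (_ * _); apply: eq_bigr => i _; rewrite !mxE. Qed.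

End Assembly.

(** * Integrability from fourth moments *)

Section Moments.
Context {R : realType} {d : measure_display} {Omega : measurableType d}.
Context (P : probability Omega R) {p : nat}.
Context (xi : Omega -> 'rV[R]_p) (w : Omega -> R).
Hypothesis mxi : measurable_fun setT (xi : Omega -> borel 'rV[R]_p).
Hypothesis mw : measurable_fun setT w.
Hypothesis w4 : ('E_P[fun omega => (w omega ^+ 4)%R] < +oo)%E.
Hypothesis xi4 : ('E_P[fun omega => (enorm (xi omega)^T ^+ 4)%R] < +oo)%E.

Lemma measurable_entry j : measurable_fun setT (fun t => xi t 0 j).
Proof. exact: (measurableT_comp (measurable_coord 0 j) mxi). Qed.

Lemma enorm4E (y : 'rV[R]_p) : enorm y^T ^+ 4 = (\sum_j y 0 j ^+ 2) ^+ 2.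
Proof.
rewrite (exprM _ 2 2) sqr_sqrtr ?dotp_ge0//; congr (_ ^+ 2).
by apply: eq_bigr => j _; rewrite mxE expr2.
Qed.

Lemma entry4_integrable j : P.-integrable setT (fun t => (xi t 0 j ^+ 4)%:E).
Proof.
apply/integrableP; split.
  by apply/measurable_EFinP; apply: measurable_funX; exact: measurable_entry.
apply: le_lt_trans xi4; rewrite unlock; apply: ge0_le_integral => //.
- apply: measurableT_comp => //; apply/measurable_EFinP.
  by apply: measurable_funX; exact: measurable_entry.
- apply/measurable_EFinP; under eq_fun do rewrite enorm4E.
  apply: measurable_funX; apply: measurable_sum => i.
  by apply: measurable_funX; exact: measurable_entry.
- move=> t _; rewrite enorm4E (exprM _ 2 2) abse_EFin lee_fin.
  rewrite ger0_norm ?sqr_ge0// lerXn2r ?nnegrE ?sqr_ge0//.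
    by apply: sumr_ge0 => i _; exact: sqr_ge0.
  by rewrite (bigD1 j)//= lerDl sumr_ge0// => i _; exact: sqr_ge0.
Qed.

Lemma noise4_integrable : P.-integrable setT (fun t => (w t ^+ 4)%:E).
Proof.
apply/integrableP; split; first by apply/measurable_EFinP; exact: measurable_funX.
move: w4; rewrite unlock; apply: le_lt_trans.
under eq_integral do
  rewrite abse_EFin ger0_norm ?(exprM _ 2 2) ?sqr_ge0// -(exprM _ 2 2).
exact: lexx.
Qed.

Lemma sqr_mul_integrable (X Y : Omega -> R) :
  measurable_fun setT X -> measurable_fun setT Y ->
  P.-integrable setT (fun t => (X t ^+ 4)%:E) ->
  P.-integrable setT (fun t => (Y t ^+ 4)%:E) ->
  P.-integrable setT (fun t => ((X t * Y t) ^+ 2)%:E).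
Proof.
move=> mX mY X4 Y4.
have : P.-integrable setT (fun t => (X t ^+ 2 * Y t ^+ 2)%:E).
  apply: integrable_mul; [exact: measurable_funX|exact: measurable_funX|..].
    by apply: eq_integrable X4 => // t _; rewrite -exprM.
  by apply: eq_integrable Y4 => // t _; rewrite -exprM.
by apply: eq_integrable => // t _; rewrite exprMn.
Qed.

End Moments.

(** * Concentration and model consistency *)

Section SampleConcentration.
Context {R : realType} {d : measure_display} {Omega : measurableType d}.
Context (P : probability Omega R) {p : nat}.
Context (xi : nat -> Omega -> 'rV[R]_p) (w : nat -> Omega -> R).
Hypothesis samples_iid : iid P
  (fun i omega => (xi i omega, w i omega) : (borel 'rV[R]_p * R)%type).
Hypothesis noise_centered : is_cond_expectation P (w 0%N)
  (xi 0%N : Omega -> borel 'rV[R]_p) (cst 0).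
Hypothesis noise_moment4 : ('E_P[fun omega => (w 0%N omega ^+ 4)%R] < +oo)%E.
Hypothesis row_moment4 :
  ('E_P[fun omega => (enorm (xi 0%N omega)^T ^+ 4)%R] < +oo)%E.

Let sample i omega : (borel 'rV[R]_p * R)%type := (xi i omega, w i omega).

Let msample i : measurable_fun setT (sample i).
Proof. by have [+ _ _] := samples_iid; exact. Qed.

Let mxi i : measurable_fun setT (xi i : Omega -> borel 'rV[R]_p).
Proof. exact: (measurableT_comp measurable_fst (msample i)). Qed.

Let mw i : measurable_fun setT (w i).
Proof. exact: (measurableT_comp measurable_snd (msample i)). Qed.

Let entry4 j := entry4_integrable (mxi 0) row_moment4 j.
Let noise4 := noise4_integrable (mw 0) noise_moment4.
Let mentry j := measurable_entry (mxi 0) j.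

Let Gt := second_moment P (xi 0%N).

(** The averages of these functions over the sample are the entries of Gamma_n - Gamma~ and of e_n;
    a single index type allows a single union bound. *)
Definition deviation (q : ('I_p * 'I_p) + 'I_p)
    (z : (borel 'rV[R]_p * R)%type) : R :=
  match q with
  | inl (j, k) => (z.1 : 'rV[R]_p) 0 j * (z.1 : 'rV[R]_p) 0 k - Gt j k
  | inr j => (z.1 : 'rV[R]_p) 0 j * z.2
  end.

Let mdeviation q : measurable_fun setT (deviation q).
Proof.
have mc j : measurable_fun setT (fun z : (borel 'rV[R]_p * R)%type =>
    (z.1 : 'rV[R]_p) 0 j).
  exact: (measurableT_comp (measurable_coord 0 j) measurable_fst).
case: q => [[j k]|j]/=.
  by apply: measurable_funB => //; exact: measurable_funM.
by apply: measurable_funM.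
Qed.

Let prod_integrable j k :
  P.-integrable setT (fun t => (xi 0%N t 0 j * xi 0%N t 0 k)%:E).
Proof.
have := sqr_mul_integrable (mentry j) (mentry k) (entry4 j) (entry4 k).
by apply: integrable_sqr_integrable; exact: measurable_funM.
Qed.

Let deviation_sqr_integrable q :
  P.-integrable setT (fun t => (deviation q (sample 0%N t) ^+ 2)%:E).
Proof.
case: q => [[j k]|j]; last first.
  exact: (sqr_mul_integrable (mentry j) (mw 0) (entry4 j) noise4).
pose X t := xi 0%N t 0 j * xi 0%N t 0 k.
have mX : measurable_fun setT X by exact: measurable_funM.
have X2 : P.-integrable setT (fun t => (X t ^+ 2)%:E).
  exact: (sqr_mul_integrable (mentry j) (mentry k) (entry4 j) (entry4 k)).
have c2 : P.-integrable setT (fun=> (Gt j k ^+ 2)%:E).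
  exact: finite_measure_integrable_cst.
(* The dominating function comes from (X - c)^2 <= 2 (X^2 + c^2). *)
have := integrableZl measurableT 2 (integrableD measurableT X2 c2).
apply: le_integrable => //.
  apply/measurable_EFinP; apply: measurable_funX.
  by apply: measurable_funB.
move=> t _; rewrite -EFinD -EFinM !abse_EFin lee_fin -/(X t).
rewrite !ger0_norm ?sqr_ge0 ?mulr_ge0 ?addr_ge0 ?sqr_ge0//=.
have := sqr_ge0 (X t + Gt j k).
by rewrite /X !expr2; nra.
Qed.

Let deviation_centered q : (\int[P]_t (deviation q (sample 0%N t))%:E = 0)%E.
Proof.
case: q => [[j k]|j] /=.
  have iG : P.-integrable setT (fun=> (Gt j k)%:E).
    exact: finite_measure_integrable_cst.
  under eq_integral do rewrite EFinB.
  have EG : (\int[P]_t (Gt j k)%:E = (Gt j k)%:E)%E.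
    by have := expectation_cst P (Gt j k); rewrite unlock.
  rewrite integralB// EG.
  rewrite /Gt /second_moment mxE unlock.
  under [X in fine X]eq_integral do rewrite mxE big_ord1 mxE.
  by rewrite fineK ?subee//; exact: integrable_fin_num.
(* The conditional expectation being 0, the noise has zero integral over every event generated by
   the row. *)
have [iw _ _ Ew] := noise_centered.
apply: (integral_mul_centered (V := xi 0%N : Omega -> borel 'rV[R]_p)
  (mxi 0) iw _ (measurable_coord 0 j)).
  move=> B mB; rewrite -[X in integral _ X]setTI Ew; last by exists B.
  exact: integral0.
apply: integrable_sqr_integrable; first exact: measurable_funM.
exact: (sqr_mul_integrable (mentry j) (mw 0) (entry4 j) noise4).
Qed.

(** Chebyshev's bound at level n b for each entry, then a union bound; [S] is the sum of the second
    moments. The constant is uniform in [b], which may therefore shrink with [n]. *)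
Lemma sample_concentration : exists S : R, forall n b, (0 < n)%N -> 0 < b ->
  exists B : set Omega, [/\ measurable B, (P B <= (S / (n%:R * b ^+ 2))%:E)%E &
    forall omega, ~ B omega -> `|emp_cov xi n omega - Gt| < b /\
      `|emp_noise xi w n omega| < b].
Proof.
pose s q := fine (\int[P]_t (deviation q (sample 0%N t) ^+ 2)%:E).
exists (\sum_q s q) => n b n0 b0.
have nR : 0 < n%:R :> R by rewrite ltr0n.
have a0 : 0 < n%:R * b by rewrite mulr_gt0.
pose D q t := \sum_(i < n) deviation q (sample i t).
have mD q : measurable_fun setT (D q).
  by apply: measurable_sum => i; exact: measurableT_comp.
pose E q := [set t | n%:R * b <= `|D q t|].
have mE q : measurable (E q).
  have := measurableT_comp (@normr_measurable R setT) (mD q).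
  move=> /(_ measurableT _ (measurable_itv `[n%:R * b, +oo[)); rewrite setTI.
  by congr measurable; apply/seteqP; split => t; rewrite /E/= in_itv/= andbT.
have PE q : (P (E q) <= (s q / (n%:R * b ^+ 2))%:E)%E.
  have := iid_sum_bound samples_iid (@mdeviation q) (deviation_sqr_integrable q)
    (deviation_centered q) n a0.
  rewrite -lee_pdivlMr ?exprn_gt0// => /le_trans; apply.
  have -> : s q / (n%:R * b ^+ 2) = n%:R * s q / (n%:R * b) ^+ 2.
    by field; rewrite !gt_eqF.
  exact: lexx.
exists (\big[setU/set0]_q E q); split.
- exact: bigsetU_measurable.
- by rewrite mulr_suml; exact: probability_bigsetU_le.
- move=> omega nE; have Dlt q : `|n%:R^-1 * D q omega| < b.
    rewrite normrM gtr0_norm ?invr_gt0// ltr_pdivrMl// ltNge; apply/negP => EqO.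
    by apply: nE; rewrite -bigcup_seq; exists q => //=; rewrite mem_index_enum.
  have mx_lt m (A : 'M[R]_(p, m)) : (forall i j, `|A i j| < b) -> `|A| < b.
    move=> Ab; rewrite /Num.Def.normr/= mx_normrE.
    by apply/bigmax_ltP; split => // -[i j] _; exact: Ab.
  split; apply: mx_lt => i j.
    have -> : (emp_cov xi n omega - Gt) i j = n%:R^-1 * D (inl (i, j)) omega.
      rewrite [LHS]mxE emp_covE [X in _ + X]mxE /D sumrB mulrBr.
      congr (_ - _); rewrite sumr_const card_ord -[X in _ * X]mulr_natl.
      by rewrite mulKf// gt_eqF.
    exact: Dlt.
  by rewrite ord1 emp_noiseE; exact: (Dlt (inr i)).
Qed.

End SampleConcentration.

Theorem theorem2 (R : realType) (d : measure_display) (Omega : measurableType d)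
    (P : probability Omega R) (p : nat) (x0 : 'cV[R]_p)
    (J : 'cV[R]_p -> R) (M : set 'cV[R]_p)
    (xi : nat -> Omega -> 'rV[R]_p) (w : nat -> Omega -> R) (mu : nat -> R)
    (X : nat -> Omega -> 'cV[R]_p)
    (J_ge0 : forall x, 0 <= J x)
    (J_convex : convex_function setT J)
    (J_psmooth : locally_partly_smooth J M x0)
    (samples_iid : iid P
       (fun i omega => (xi i omega, w i omega) : (borel 'rV[R]_p * R)%type))
    (noise_centered : forall i,
       is_cond_expectation P (w i) (xi i : Omega -> borel 'rV[R]_p) (cst 0))
    (noise_moment4 : forall i, ('E_P[fun omega => (w i omega ^+ 4)%R] < +oo)%E)
    (row_moment4 : forall i,
       ('E_P[fun omega => (enorm (xi i omega)^T ^+ 4)%R] < +oo)%E)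
    (mu_gt0 : forall n, (0 < n)%N -> 0 < mu n)
    (injectivity : forall x, second_moment P (xi 0%N) *m x = 0 ->
       model_space J x0 x -> x = 0)
    (nondegeneracy : relint (subdifferential J x0)
       (precertificate J x0 (second_moment P (xi 0%N))))
    (mu_small : mu =o_\oo (fun _ : nat => 1 : R))
    (mu_large : (fun n => ((mu n)^-1)%R) =o_\oo (fun n : nat => Num.sqrt n%:R : R))
    (X_measurable : forall n, (0 < n)%N ->
       measurable_fun setT (X n : Omega -> borel 'cV[R]_p))
    (X_solution : forall n omega, (0 < n)%N ->
       solutions J (mu n) (emp_corr xi w x0 n omega) (emp_cov xi n omega)
         !=set0 ->
       solutions J (mu n) (emp_corr xi w x0 n omega) (emp_cov xi n omega)
         (X n omega)) :
  (fun n => P (X n @^-1` M)) @ \oo --> 1%E.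
Proof.
have [Mx0 manM psnear] := J_psmooth.
have psx0 : partly_smooth J M x0 by exact: (nbhs_singleton psnear).
have mM := C2_manifold_borel manM.
have [del del0 stable] := stable_strict_minimizer psx0 injectivity nondegeneracy.
have [S conc] := sample_concentration samples_iid (noise_centered 0%N)
  (noise_moment4 0%N) (row_moment4 0%N).
(* The failure probability for deviations of size del mu_n; it vanishes because 1 / (mu_n sqrt n)
   does. *)
pose t n := S / (n%:R * (del * mu n) ^+ 2).
have t0 : t @ \oo --> (0 : R).
  pose r n := (mu n)^-1 / Num.sqrt n%:R.
  have r0 : r @ \oo --> (0 : R).
    apply/cvgr0Pnorm_le => e e0; have /eqoP/(_ _ e0) := mu_large.
    (* The index 0 is discarded: one divides by [Num.sqrt n%:R]. *)
    apply: filterS2 (nbhs_infty_gt 0) => n n0.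
    rewrite [X in _ <= _ * X]ger0_norm ?sqrtr_ge0// => rn.
    have -> : `|r n| = `|(mu n)^-1| / Num.sqrt n%:R.
      by rewrite /r normrM [X in _ * X]ger0_norm ?invr_ge0 ?sqrtr_ge0.
    by rewrite ler_pdivrMr// sqrtr_gt0 ltr0n.
  have : (fun n => S / del ^+ 2 * (r n * r n)) @ \oo --> (0 : R).
    have -> : 0 = S / del ^+ 2 * (0 * 0) :> R by rewrite !mulr0.
    by apply: cvgM; [exact: cvg_cst|exact: cvgM].
  apply: cvg_trans; apply: near_eq_cvg.
  apply: filterS (nbhs_infty_gt 0) => n n0.
  have mun := mu_gt0 n n0; have nR : 0 < n%:R :> R by rewrite ltr0n.
  have rr : r n * r n = (mu n) ^- 2 / n%:R.
    rewrite /r -expr2 exprMn exprVn; congr (_ * _).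
    by rewrite exprVn sqr_sqrtr// ltW.
  by rewrite rr /t; field; rewrite !gt_eqF.
have mu_le e : 0 < e -> \forall n \near \oo, mu n < e.
  move=> e0; have e2 : 0 < e / 2 by rewrite divr_gt0.
  have /eqoP/(_ _ e2) := mu_small; apply: filterS => n.
  rewrite normr1 mulr1 => mue; rewrite (le_lt_trans (ler_norm _))//.
  by rewrite (le_lt_trans mue)// ltr_pdivrMr// ltr_pMr// ltr1n.
have lower : \forall n \near \oo,
    ((1 - t n)%:E <= P (X n @^-1` M) <= 1)%E.
  near=> n.
  have n0 : (0 < n)%N by near: n; exact: nbhs_infty_gt.
  have mun : mu n < del by near: n; exact: mu_le.
  (* With mu_n < 1, the single level del mu_n controls the covariance error by [del] as well. *)
  have mun1 : mu n < 1 by near: n; exact: mu_le.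
  have mXM : measurable (X n @^-1` M).
    by rewrite -[X in measurable X]setTI; exact: X_measurable.
  rewrite probability_le1// andbT.
  have [B [mB PB good]] := conc n (del * mu n) n0 (mulr_gt0 del0 (mu_gt0 n n0)).
  have BX : ~` B `<=` X n @^-1` M.
    move=> omega /good[cov_lt noise_lt]; rewrite /preimage/=.
    have cov_lt' : `|emp_cov xi n omega - second_moment P (xi 0%N)| < del.
      by rewrite (lt_le_trans cov_lt)// ger_pMr// ltW.
    have [y [My ymin]] := stable _ _ _ (mu_gt0 n n0) mun
      (emp_cov_sym xi n omega) (emp_cov_ge0 xi n omega) cov_lt' noise_lt.
    (* A solution exists, so [X n omega] is one, and all solutions lie in [M]. *)
    have [ex_sol solM] := strict_minimizer_solution (emp_cov_sym xi n omega) My ymin.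
    rewrite -emp_corrE in ex_sol solM.
    exact/solM/X_solution.
  apply: (@le_trans _ _ (P (~` B))); last first.
    by apply: le_measure; rewrite ?inE//; exact: measurableC.
  by rewrite probability_setC// EFinB leeB.
apply: (squeeze_cvge lower); last exact: cvg_cst.
apply: cvg_EFin; first exact: nearW.
rewrite -[X in _ --> X](subr0 1); apply: cvgB => //; exact: cvg_cst.
Unshelve. all: by end_near.
Qed.
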